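(* Any bounded linear operator in $\mathcal{F}^2(\mathbb{C})$ is a Toeplitz operator with symbol of weak almost-finite type; that is, for every bounded operator $T$ on $\mathcal{F}^2(\mathbb{C})$ the sesquilinear form $F(f,g)=\langle Tf,g\rangle$ (for which $T=T_F$) is a symbol of weak almost-finite type.
   Context: $\mathcal{F}^2(\mathbb{C})$ is the Fock space of entire functions $f$ with $\|f\|_{\mathcal{F}^2}^2=\int_{\mathbb{C}}|f(z)|^2\,\omega(z)\,dV(z)<\infty$, where $\omega(z)=\pi^{-1}e^{-|z|^2}$ and $dV$ is Lebesgue measure on $\mathbb{C}$; its reproducing kernel is $\mathbf{k}_z(w)=e^{w\overline z}$. For a bounded sesquilinear form $F$ on $\mathcal{F}^2(\mathbb{C})$, the Toeplitz operator $T_F$ is $(T_Ff)(z)=F(f,\mathbf{k}_z)$, equivalently $\langle T_Ff,g\rangle=F(f,g)$. Measures are complex-valued Borel measures on $\mathbb{C}$ that are locally finite (possibly of infinite total variation); $|\mu|$ is the variation of $\mu$. For integer $k\ge0$, $\mu$ is a $k$-FC measure if there is a constant $\varpi_k(\mu)<\infty$ with $\int_{\mathbb{C}}|f^{(k)}(z)|^2e^{-|z|^2}d|\mu|(z)\le\varpi_k(\mu)\|f\|_{\mathcal{F}^2}^2$ for all $f\in\mathcal{F}^2(\mathbb{C})$; for half-integer $k\ge0$, $\mu$ is a $k$-FC measure if $\sup_{z\in\mathbb{C}}|\mu|(B(z,\sqrt2))(1+|z|^2)^k<\infty$, where $B(z,r)$ is the disk of radius $r$ centered at $z$. A bounded sesquilinear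 form $F$ on $\mathcal{F}^2(\mathbb{C})$ is a symbol of weak almost-finite type if there exists a collection $\{\mu_{\alpha,\beta}\}_{\alpha,\beta=0,1,2,\dots}$ of $(\alpha+\beta)/2$-FC measures such that, for all $f,g\in\mathcal{F}^2(\mathbb{C})$, the series $$\sum_{j=0}^\infty\ \sum_{\max(\alpha,\beta)=j}F_{\alpha,\beta}(f,g)$$ converges to $F(f,g)$, where $$F_{\alpha,\beta}(f,g)=(\boldsymbol{\partial}^\alpha\overline{\boldsymbol{\partial}}^{\beta}\mu_{\alpha,\beta},f\bar g)=(-1)^{\alpha+\beta}\int_{\mathbb{C}}f^{(\alpha)}(z)\overline{g^{(\beta)}(z)}\,\omega(z)\,d\mu_{\alpha,\beta}(z).$$ *)

(* Defs.v *)
From HB Require Import structures.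
From mathcomp Require Import all_boot all_order all_algebra.
From mathcomp Require Import complex.
From mathcomp Require Import all_classical all_reals all_analysis.

Set Implicit Arguments.
Unset Strict Implicit.
Unset Printing Implicit Defensive.

Import Order.TTheory GRing.Theory Num.Theory.
Import numFieldNormedType.Exports.

Local Open Scope classical_set_scope.
Local Open Scope ring_scope.
Local Open Scope complex_scope.

(* Measure theory on C is done on pairs [(x, y)] standing for [x +i* y]; the
   product of the two Borel sigma-algebras of R is the Borel sigma-algebra of
   R^2. [measurableTypeR R] is the copy of [R] carrying [lebesgue_measure]. *)
Notation plane R := (measurableTypeR R * measurableTypeR R)%type.

Definition pt {R : realType} (p : plane R) : R[i] := (p.1 : R) +i* (p.2 : R).

(* The library norm [`|z|] on [R[i]] is valued in [R[i]]; this is its real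
   value. *)
Definition cabs {R : realType} (z : R[i]) : R := complex.Re `|z|.

Definition cexp {R : realType} (z : R[i]) : R[i] :=
  let: x +i* y := z in (expR x * cos y) +i* (expR x * sin y).

Definition area {R : realType} : {measure set (plane R) -> \bar R} :=
  (@lebesgue_measure R \x @lebesgue_measure R)%E.

Definition disk {R : realType} (z : R[i]) (r : R) : set (plane R) :=
  [set p | cabs (pt p - z) < r].

(* [R[i]^o] carries the topology and the normed-module structure over [R[i]],
   so that derivatives below are complex derivatives. *)
Definition entire {R : realType} (f : R[i] -> R[i]) : Prop :=
  forall z : R[i]^o, derivable (f : R[i]^o -> R[i]^o) z 1.

Definition cderiv {R : realType} (n : nat) (f : R[i] -> R[i]) : R[i] -> R[i] :=
  derive1n n (f : R[i] -> R[i]^o).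

Definition omega {R : realType} (z : R[i]) : R := pi^-1 * expR (- cabs z ^+ 2).

Definition fock_sqnorm {R : realType} (f : R[i] -> R[i]) : \bar R :=
  (\int[area]_p (cabs (f (pt p)) ^+ 2 * omega (pt p))%:E)%E.

Definition fock {R : realType} (f : R[i] -> R[i]) : Prop :=
  entire f /\ (fock_sqnorm f < +oo)%E.

Definition fock_norm {R : realType} (f : R[i] -> R[i]) : R :=
  Num.sqrt (fine (fock_sqnorm f)).

Definition fock_inner {R : realType} (f g : R[i] -> R[i]) : R[i] :=
  let h (p : plane R) := f (pt p) * (g (pt p))^* * (omega (pt p))%:C in
  (\int[area]_p complex.Re (h p)) +i* (\int[area]_p complex.Im (h p)).

Definition fock_kernel {R : realType} (z w : R[i]) : R[i] := cexp (w * z^*).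

(* Operators and forms on the Fock space are total on functions; only their
   values on [fock] matter. *)
Definition bounded_operator {R : realType}
    (T : (R[i] -> R[i]) -> (R[i] -> R[i])) : Prop :=
  [/\ forall f, fock f -> fock (T f),
      forall (a : R[i]) f g, fock f -> fock g ->
        T (fun z => a * f z + g z) =1 (fun z => a * T f z + T g z)
    & exists M : R, forall f, fock f -> fock_norm (T f) <= M * fock_norm f].

Definition bounded_sesquilinear {R : realType}
    (F : (R[i] -> R[i]) -> (R[i] -> R[i]) -> R[i]) : Prop :=
  [/\ forall (a : R[i]) f1 f2 g, fock f1 -> fock f2 -> fock g ->
        F (fun z => a * f1 z + f2 z) g = a * F f1 g + F f2 g,
      forall (a : R[i]) f g1 g2, fock f -> fock g1 -> fock g2 ->
        F f (fun z => a * g1 z + g2 z) = a^* * F f g1 + F f g2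
    & exists M : R, forall f g, fock f -> fock g ->
        cabs (F f g) <= M * fock_norm f * fock_norm g].

Definition toeplitz {R : realType}
    (F : (R[i] -> R[i]) -> (R[i] -> R[i]) -> R[i])
    (f : R[i] -> R[i]) : R[i] -> R[i] :=
  fun z => F f (fock_kernel z).

Definition bounded_borel {R : realType} (A : set (plane R)) : Prop :=
  measurable A /\ exists r : R, A `<=` disk 0 r.

(* A locally finite complex measure may have infinite total variation, so it is
   a countably additive function of the bounded Borel sets only; its values on
   other sets are irrelevant. *)
Definition lf_complex_measure {R : realType} (mu : set (plane R) -> R[i]) : Prop :=
  forall A : nat -> set (plane R),
    (forall i, measurable (A i)) -> trivIset setT A ->
    bounded_borel (\bigcup_i A i) ->
    ((fun n => \sum_(0 <= i < n) mu (A i)) : nat -> R[i]^o) @ \oo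
      --> (mu (\bigcup_i A i) : R[i]^o).

(* Finite families of disjoint bounded pieces give the same supremum as
   countable Borel partitions of [A]. *)
Definition abs_measure {R : realType} (mu : set (plane R) -> R[i])
    (A : set (plane R)) : \bar R :=
  ereal_sup [set x | exists n (E : 'I_n -> set (plane R)),
    [/\ forall i, bounded_borel (E i) /\ E i `<=` A,
        trivIset setT E
      & x = (\sum_(i < n) cabs (mu (E i)))%:E]].

(* Positive part in the Jordan decomposition of a locally finite signed
   measure; the negative part is the positive part of [- nu]. *)
Definition positive_part {R : realType} (nu : set (plane R) -> R)
    (A : set (plane R)) : \bar R :=
  ereal_sup [set (nu B)%:E | B in [set B | bounded_borel B /\ B `<=` A]].

Definition signed_integral {R : realType} (nu : set (plane R) -> R)
    (h : plane R -> R) : R :=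
  fine (\int[positive_part nu]_p (h p)%:E)%E -
  fine (\int[positive_part (fun A => (- nu A)%R)]_p (h p)%:E)%E.

Definition complex_integral {R : realType} (mu : set (plane R) -> R[i])
    (h : plane R -> R[i]) : R[i] :=
  let mu1 A := complex.Re (mu A) in
  let mu2 A := complex.Im (mu A) in
  let h1 p := complex.Re (h p) in
  let h2 p := complex.Im (h p) in
  (signed_integral mu1 h1 - signed_integral mu2 h2)
    +i* (signed_integral mu2 h1 + signed_integral mu1 h2).

Definition FC_integer {R : realType} (k : nat)
    (mu : set (plane R) -> R[i]) : Prop :=
  exists w : R, forall f : R[i] -> R[i], fock f ->
    (\int[abs_measure mu]_p
        (cabs (cderiv k f (pt p)) ^+ 2 * expR (- cabs (pt p) ^+ 2))%:E
     <= w%:E * fock_sqnorm f)%E.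

Definition FC_half_integer {R : realType} (k : R)
    (mu : set (plane R) -> R[i]) : Prop :=
  exists M : R, forall z : R[i],
    (abs_measure mu (disk z (Num.sqrt 2%:R))
       * ((1 + cabs z ^+ 2) `^ k)%:E <= M%:E)%E.

(* [FC n mu]: mu is an (n/2)-FC measure. *)
Definition FC {R : realType} (n : nat) (mu : set (plane R) -> R[i]) : Prop :=
  if odd n then FC_half_integer (n%:R / 2%:R : R) mu else FC_integer n./2 mu.

Definition F_ab {R : realType} (mu : set (plane R) -> R[i]) (a b : nat)
    (f g : R[i] -> R[i]) : R[i] :=
  (-1) ^+ (a + b) *
  complex_integral mu (fun p =>
    cderiv a f (pt p) * (cderiv b g (pt p))^* * (omega (pt p))%:C).

Definition weak_almost_finite {R : realType}
    (F : (R[i] -> R[i]) -> (R[i] -> R[i]) -> R[i]) : Prop :=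
  bounded_sesquilinear F /\
  exists mu : nat -> nat -> set (plane R) -> R[i],
    (forall a b, lf_complex_measure (mu a b) /\ FC (a + b) (mu a b)) /\
    forall f g, fock f -> fock g ->
      ((fun n => \sum_(0 <= j < n)
          \sum_(a < j.+1) \sum_(b < j.+1 | maxn a b == j)
            F_ab (mu a b) a b f g) : nat -> R[i]^o) @ \oo
        --> (F f g : R[i]^o).

(* Main.v *)
Require Import Defs.
From HB Require Import structures.
From mathcomp Require Import all_boot all_order all_algebra.
From mathcomp Require Import complex.
From mathcomp Require Import all_classical all_reals all_analysis.
From mathcomp Require Import measurable_realfun ring lra.

(** Evaluation of derivatives at the origin is all that is needed.  On the
    orthogonal basis of monomials, [f^(n)(0) = <f, w^n>], so a point mass at the
    origin with weight [c] turns [F_(a,b)(f, g)] into a constant multiple of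
    [<f, w^a>] times the conjugate of [<g, w^b>], that is, into a single entry
    of the matrix of an operator.  Choosing the weight of the (a, b)-th mass so
    that it produces the entry [<T w^a, w^b>], the shells [max(a, b) < n] add up
    to [<T (P_n f), P_n g>], where [P_n] is the Taylor projection onto
    polynomials of degree less than [n]; this tends to [<T f, g>] because [T] is
    bounded and [P_n f -> f] in norm.  A point mass is a k-FC measure for every
    [k]: at the origin the k-th derivative is the bounded functional
    [f |-> <f, w^k>], and for half-integer [k] its support is bounded.

    The rest is the function theory of the Fock space, starting from pointwise
    complex differentiability.
    - The circulation of a pointwise differentiable closed form around a square
      vanishes, by bisection ([circulation_eq0]).  Applied to [f(u e^(s+it))],
      which is periodic in [t], it shows that the mean over a circle centred at
      the origin does not depend on the radius ([circle_mean_Re]).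
    - The Gaussian measure is invariant under rotations; averaging over them
      gives [<f, 1> = f(0)] ([fock_mean]), and translating by a Weyl operator
      gives the reproducing formula [<f, k_z> = f(z)] ([fock_reproducing]).
    - Differentiating the reproducing formula in [z] gives
      [f^(n)(z) = <f, w^n k_z>] ([cderiv_moment]).  At [z = 0] this is the
      formula above, and with [f] a monomial it gives the orthogonality
      relations ([mono_orthogonal]).
    - The kernels satisfy [|k_z - P_n k_z|^2 = e^(|z|^2) - sum_(j<n) |z|^(2j)/j!],
      which tends to [0], so [P_n f -> f] pointwise; Fatou's lemma upgrades this
      to convergence in norm ([taylor_norm_cvg]). *)

Set Implicit Arguments.
Unset Strict Implicit.
Unset Printing Implicit Defensive.

Import Order.TTheory GRing.Theory Num.Theory.
Import numFieldNormedType.Exports.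

Local Open Scope classical_set_scope.
Local Open Scope complex_scope.
Local Open Scope ring_scope.

(** * Modulus, conjugation and exponential of complex numbers *)

Section ComplexBasics.
Context {R : realType}.
Implicit Types (z w h a b : R[i]) (x y : R).

Lemma cabsE z : cabs z = Num.sqrt (complex.Re z ^+ 2 + complex.Im z ^+ 2).
Proof. by rewrite /cabs normc_def. Qed.

Lemma cabsC z : (cabs z)%:C = `|z|.
Proof. by rewrite cabsE normc_def. Qed.

Lemma cabs_ge0 z : 0 <= cabs z.
Proof. by rewrite cabsE sqrtr_ge0. Qed.

Lemma cabs_sqr z : cabs z ^+ 2 = complex.Re z ^+ 2 + complex.Im z ^+ 2.
Proof. by rewrite cabsE sqr_sqrtr// addr_ge0// sqr_ge0. Qed.

Lemma cabsM z w : cabs (z * w) = cabs z * cabs w.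
Proof. by apply: complexI; rewrite rmorphM/= !cabsC normrM. Qed.

Lemma cabsX z n : cabs (z ^+ n) = cabs z ^+ n.
Proof. by apply: complexI; rewrite rmorphXn/= !cabsC normrX. Qed.

Lemma cabsD z w : cabs (z + w) <= cabs z + cabs w.
Proof. by rewrite -lecR rmorphD/= !cabsC ler_normD. Qed.

Lemma cabsN z : cabs (- z) = cabs z.
Proof. by apply: complexI; rewrite !cabsC normrN. Qed.

Lemma cabsJ z : cabs z^* = cabs z.
Proof. by apply: complexI; rewrite !cabsC -[z^*]/(conjc z) normcJ. Qed.

Lemma cabs0 : cabs (0 : R[i]) = 0.
Proof. by apply: complexI; rewrite !cabsC normr0. Qed.

Lemma cabs1 : cabs (1 : R[i]) = 1.
Proof. by apply: complexI; rewrite !cabsC normr1. Qed.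

Lemma cabs_eq0 z : (cabs z == 0) = (z == 0).
Proof. by rewrite -(inj_eq (@complexI R)) cabsC normr_eq0. Qed.

Lemma cabs_real x : cabs x%:C = `|x|.
Proof. by rewrite cabsE/= expr0n/= addr0 sqrtr_sqr. Qed.

Lemma ger0_cabs x : 0 <= x -> cabs x%:C = x.
Proof. by move=> x0; rewrite cabs_real ger0_norm. Qed.

Lemma cabs_distrC z w : cabs (z - w) = cabs (w - z).
Proof. by rewrite -cabsN opprB. Qed.

Lemma Re_le_cabs z : `|complex.Re z| <= cabs z.
Proof. by rewrite -lecR cabsC normc_ge_Re. Qed.

Lemma Im_le_cabs z : `|complex.Im z| <= cabs z.
Proof.
rewrite -(ger0_norm (cabs_ge0 z)) -ler_sqr ?nnegrE// !real_normK ?num_real//.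
by rewrite cabs_sqr lerDr sqr_ge0.
Qed.

Lemma cabs_le_ReIm z : cabs z <= `|complex.Re z| + `|complex.Im z|.
Proof.
rewrite -ler_sqr ?nnegrE ?cabs_ge0 ?addr_ge0// cabs_sqr sqrrD !real_normK ?num_real//.
by rewrite addrAC lerDl mulrn_wge0// mulr_ge0.
Qed.

Lemma ReM z w : complex.Re (z * w) = complex.Re z * complex.Re w - complex.Im z * complex.Im w.
Proof. by case: z; case: w. Qed.

Lemma ImM z w : complex.Im (z * w) = complex.Re z * complex.Im w + complex.Im z * complex.Re w.
Proof. by case: z => a b; case: w. Qed.

Lemma ReD z w : complex.Re (z + w) = complex.Re z + complex.Re w.
Proof. by case: z; case: w. Qed.

Lemma ImD z w : complex.Im (z + w) = complex.Im z + complex.Im w.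
Proof. by case: z; case: w. Qed.

Lemma ReN z : complex.Re (- z) = - complex.Re z.
Proof. by case: z. Qed.

Lemma ImN z : complex.Im (- z) = - complex.Im z.
Proof. by case: z. Qed.

Lemma ReJ z : complex.Re z^* = complex.Re z.
Proof. by case: z. Qed.

Lemma ImJ z : complex.Im z^* = - complex.Im z.
Proof. by case: z. Qed.

Lemma complex_ext z w :
  complex.Re z = complex.Re w -> complex.Im z = complex.Im w -> z = w.
Proof. by case: z => a b; case: w => c d /= -> ->. Qed.

Lemma mulrJ z : z * z^* = (cabs z ^+ 2)%:C.
Proof. by rewrite rmorphXn/= cabsC sqr_normc. Qed.

Lemma conjD z w : (z + w)^* = z^* + w^*.
Proof. exact: rmorphD. Qed.

Lemma conjM z w : (z * w)^* = z^* * w^*.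
Proof. exact: rmorphM. Qed.

Lemma conjN z : (- z)^* = - z^*.
Proof. exact: rmorphN. Qed.

Lemma conjB z w : (z - w)^* = z^* - w^*.
Proof. exact: rmorphB. Qed.

Lemma conjK z : z^*^* = z.
Proof. exact: conjCK. Qed.

Lemma conjR x : (x%:C)^* = x%:C.
Proof. exact: conjc_real. Qed.

Lemma cexpE z : cexp z =
  (expR (complex.Re z) * cos (complex.Im z)) +i* (expR (complex.Re z) * sin (complex.Im z)).
Proof. by case: z. Qed.

Lemma cexpD z w : cexp (z + w) = cexp z * cexp w.
Proof.
case: z => a b; case: w => c d; apply: complex_ext.
  by rewrite ReM/= expRD cosD; ring.
by rewrite ImM/= expRD sinD; ring.
Qed.

Lemma cexp0 : cexp (0 : R[i]) = 1.
Proof. by apply: complex_ext; rewrite cexpE/= expR0 ?cos0 ?sin0 ?mulr1 ?mulr0. Qed.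

Lemma cexp_real x : cexp x%:C = (expR x)%:C.
Proof. by rewrite cexpE/= cos0 sin0 mulr1 mulr0. Qed.

Lemma cexpJ z : (cexp z)^* = cexp z^*.
Proof. by case: z => x y; rewrite !cexpE/= cosN sinN mulrN. Qed.

Lemma cabs_cexp z : cabs (cexp z) = expR (complex.Re z).
Proof.
rewrite cexpE cabsE/= !exprMn -mulrDr cos2Dsin2 mulr1 sqrtr_sqr ger0_norm ?expR_ge0//.
Qed.

Lemma cabs_cexp_le z : cabs (cexp z) <= expR (cabs z).
Proof. by rewrite cabs_cexp ler_expR (le_trans (ler_norm _)) ?Re_le_cabs. Qed.

End ComplexBasics.

(** * Second-order bounds for the exponential *)

Section RealBounds.
Context {R : realType}.
Implicit Types (x y : R).

Lemma expR_sub1_le x : expR x - 1 <= x * expR x.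
Proof.
have := expR_ge1Dx (- x); rewrite expRN => h.
have e0 := expR_gt0 x.
have : (1 - x) * expR x <= 1.
  rewrite -[leRHS](mulVf (lt0r_neq0 e0)) ler_wpM2r//; exact: ltW.
by rewrite mulrBl mul1r; lra.
Qed.

Lemma norm_expR_sub1 x : `|expR x - 1| <= `|x| * expR `|x|.
Proof.
have h1 := expR_ge1Dx x; have h2 := expR_sub1_le x.
have [x0|x0] := leP 0 x.
  by rewrite !ger0_norm//; lra.
rewrite ler0_norm; last by rewrite subr_le0 expR_le1 ltW.
rewrite ltr0_norm//; have : 1 <= expR (- x) by have := expR_ge1Dx (- x); lra.
move=> h; apply: (@le_trans _ _ (- x * 1)); first by lra.
by rewrite ler_pM2l //; lra.
Qed.

Lemma norm_expR_sub1D x : `|expR x - 1 - x| <= x ^+ 2 * expR `|x|.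
Proof.
have h1 := expR_ge1Dx x; have h2 := expR_sub1_le x.
rewrite ger0_norm; last by lra.
have -> : x ^+ 2 = `|x| * `|x| by rewrite -expr2 real_normK// num_real.
apply: (@le_trans _ _ (x * (expR x - 1))); first by lra.
apply: (le_trans (ler_norm _)); rewrite normrM -mulrA.
by rewrite ler_wpM2l// norm_expR_sub1.
Qed.

(** The mean value theorem on either side of the origin. *)
Lemma mvt_bound (f df : R -> R) x M :
  (forall t : R, is_derive t (1 : R) f (df t)) ->
  (forall t : R, `|t| <= `|x| -> `|df t| <= M) -> `|f x - f 0| <= M * `|x|.
Proof.
move=> fdf dfM.
have cf a b : {within `[a, b], continuous f}.
  apply: continuous_subspaceT => t.
  by apply/differentiable_continuous/derivable1_diffP; case: (fdf t).
have [x0|x0] := leP 0 x.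
  have [c] := @MVT_segment R f df 0 x x0 (fun t _ => fdf t) (cf _ _).
  rewrite in_itv/= => /andP[c0 cx] ->; rewrite subr0 normrM ler_wpM2r// dfM//.
  by rewrite !ger0_norm//.
have [c] := @MVT_segment R f df x 0 (ltW x0) (fun t _ => fdf t) (cf _ _).
rewrite in_itv/= => /andP[cx c0] h.
rewrite distrC h sub0r normrM normrN ler_wpM2r// dfM//.
by rewrite !ler0_norm ?lerN2// ltW.
Qed.

Lemma norm_sin_le x : `|sin x| <= `|x|.
Proof.
have := @mvt_bound sin cos x 1 _ (fun t _ => cos_max t).
by rewrite sin0 subr0 mul1r; apply => t; exact: is_derive_sin.
Qed.

Lemma norm_cos_sub1_le x : `|cos x - 1| <= `|x|.
Proof.
have := @mvt_bound cos (fun t => - sin t) x 1.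
by rewrite cos0 mul1r; apply => t; rewrite normrN => _; exact: sin_max.
Qed.

Lemma norm_cos_sub1_sqr x : `|cos x - 1| <= x ^+ 2.
Proof.
have := @mvt_bound cos (fun t => - sin t) x `|x|.
rewrite cos0 -expr2 real_normK ?num_real//; apply => t tx; rewrite normrN.
exact: le_trans (norm_sin_le t) tx.
Qed.

Lemma norm_sin_sub_sqr x : `|sin x - x| <= x ^+ 2.
Proof.
have := @mvt_bound (fun t => sin t - t) (fun t => cos t - 1) x `|x|.
rewrite sin0 !subr0 -expr2 real_normK ?num_real//; apply => t tx.
exact: le_trans (norm_cos_sub1_le t) tx.
Qed.

End RealBounds.

Section CexpBounds.
Context {R : realType}.
Implicit Types (z w h : R[i]).

(** Real and imaginary parts are estimated separately; this quadratic remainder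
    is what makes [cexp] differentiable and what allows differentiation under
    the integral sign later on.  The constant 4 is not sharp. *)
Lemma cabs_cexp_sub1D w : cabs (cexp w - 1 - w) <= 4 * cabs w ^+ 2 * expR (cabs w).
Proof.
have e1 : expR `|complex.Re w| <= expR (cabs w) by rewrite ler_expR Re_le_cabs.
have e0 := cabs_ge0 w.
apply: (le_trans (cabs_le_ReIm _)).
have := Re_le_cabs w; have := Im_le_cabs w.
rewrite cexpE !ReD !ImD !ReN !ImN/= subr0 in e1 *.
set x := complex.Re w in e1 *; set y := complex.Im w; set r := cabs w in e1 e0 *.
move=> yr xr.
have E1 : 1 <= expR r by have := expR_ge1Dx r; lra.
have x2 : x ^+ 2 <= r ^+ 2 by rewrite -(real_normK (num_real x)) ler_sqr ?nnegrE.
have y2 : y ^+ 2 <= r ^+ 2 by rewrite -(real_normK (num_real y)) ler_sqr ?nnegrE.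
have r2 : 0 <= r ^+ 2 by rewrite sqr_ge0.
have R1 : `|expR x * cos y - 1 - x| <= 2 * (r ^+ 2 * expR r).
  have -> : expR x * cos y - 1 - x = (expR x - 1 - x) + expR x * (cos y - 1) by ring.
  apply: (le_trans (ler_normD _ _)); rewrite (mulrDl 1 1) mul1r lerD//.
    by apply: (le_trans (norm_expR_sub1D x)); rewrite ler_pM ?sqr_ge0 ?expR_ge0.
  rewrite normrM mulrC ler_pM// ?(le_trans (norm_cos_sub1_sqr y))//.
  rewrite ger0_norm ?expR_ge0// ler_expR.
  exact: le_trans (ler_norm x) xr.
have R2 : `|expR x * sin y - y| <= 2 * (r ^+ 2 * expR r).
  have -> : expR x * sin y - y = (expR x - 1) * sin y + (sin y - y) by ring.
  apply: (le_trans (ler_normD _ _)); rewrite (mulrDl 1 1) mul1r lerD//.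
    rewrite normrM expr2 -mulrA [X in _ <= _ * X]mulrC mulrA ler_pM//.
      apply: (le_trans (norm_expR_sub1 x)); rewrite ler_pM ?expR_ge0//.
    exact: le_trans (norm_sin_le y) yr.
  apply: (le_trans (norm_sin_sub_sqr y)); rewrite (le_trans y2)//.
  by rewrite ler_peMr.
by have := lerD R1 R2; lra.
Qed.

End CexpBounds.

(** * Entire functions *)

(** Complex differentiability with the remainder measured by the real-valued
    modulus, so that the estimates below stay within the reals. *)
Definition cdiff {R : realType} (f : R[i] -> R[i]) (z D : R[i]) : Prop :=
  forall e : R, 0 < e -> exists2 d : R, 0 < d &
    forall h : R[i], cabs h < d -> cabs (f (z + h) - f z - D * h) <= e * cabs h.

Section Cdiff.
Context {R : realType}.
Implicit Types (f g : R[i] -> R[i]) (z w h D : R[i]).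

Lemma nbhs_cabsP (P : set R[i]) z :
  nbhs (z : R[i]^o) P <-> exists2 d : R, 0 < d & forall h, cabs h < d -> P (z + h).
Proof.
split.
  move=> /nbhs_ballP[e /= e0 eP]; exists (complex.Re e).
    by move: e0; rewrite ltcE/= => /andP[].
  move=> h he; apply: eP; rewrite /ball/= opprD addNKr normrN -cabsC ltcE/=.
  by move: e0; rewrite ltcE/= => /andP[/eqP -> _]; rewrite eqxx.
move=> [d d0 dP]; apply/nbhs_ballP; exists d%:C; first by rewrite /= ltcR.
move=> w; rewrite /ball/= -cabsC ltcR => zw.
by rewrite -(subrKC z w); apply: dP; rewrite cabs_distrC.
Qed.

Lemma cabsV z : z != 0 -> cabs z^-1 = (cabs z)^-1.
Proof.
move=> z0; apply: (@mulfI _ (cabs z)); first by rewrite cabs_eq0.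
by rewrite -cabsM !mulfV ?cabs1// cabs_eq0.
Qed.

Lemma cabs_gt0 z : (0 < cabs z) = (z != 0).
Proof. by rewrite lt_def cabs_eq0 cabs_ge0 andbT. Qed.

Lemma cdiff_is_derive f z D :
  cdiff f z D -> is_derive (z : R[i]^o) 1 (f : R[i]^o -> R[i]^o) D.
Proof.
move=> fD.
have H : (fun h : R[i]^o => h^-1 *: ((f : R[i]^o -> R[i]^o) (h *: 1 + z) - f z) : R[i]^o) @ 0^' --> (D : R[i]^o).
  apply/cvgrPdist_lt => /= e e0.
  have er : 0 < complex.Re e by move: e0; rewrite ltcE/= => /andP[].
  have [d d0 dP] := fD (complex.Re e / 2) (divr_gt0 er (ltr0Sn _ 1)).
  apply/nbhs_cabsP; exists d => // h hd; rewrite add0r => h0.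
  have -> : D - h^-1 *: ((f : R[i]^o -> R[i]^o) (h *: 1 + z) - f z) =
    - (h^-1 * (f (z + h) - f z - D * h)).
    by rewrite /GRing.scale/= mulr1 (addrC h z); field.
  rewrite -cabsC cabsN.
  suff : cabs (h^-1 * (f (z + h) - f z - D * h)) <= complex.Re e / 2.
    rewrite ltcE/= => H; move: e0; rewrite ltcE/= => /andP[/eqP -> _].
    by rewrite eqxx/=; lra.
  by rewrite cabsM cabsV// mulrC ler_pdivrMr ?cabs_gt0// dP.
by apply: DeriveDef; [exact: cvgP H|exact: cvg_lim H].
Qed.

Lemma derivable_cdiff f z :
  derivable (f : R[i]^o -> R[i]^o) (z : R[i]^o) 1 ->
  cdiff f z ('D_1 (f : R[i]^o -> R[i]^o) (z : R[i]^o)).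
Proof.
move=> df; set D := ('D_(1 : R[i]^o) _ _).
have : (fun h : R[i]^o => h^-1 *: ((f : R[i]^o -> R[i]^o) (h *: 1 + z) - f z) : R[i]^o) @ 0^' --> (D : R[i]^o).
  exact: df.
move=> /cvgrPdist_le/= H e e0.
have e0' : 0 < e%:C by rewrite ltcR.
have /nbhs_cabsP[d d0 dP] := H _ e0'.
exists d => // h hd; have [->|h0] := eqVneq h 0.
  by rewrite addr0 subrr mulr0 subr0 cabs0 mulr0.
have := dP h hd; rewrite add0r => /(_ h0).
have -> : D - h^-1 *: ((f : R[i]^o -> R[i]^o) (h *: 1 + z) - f z) =
    - (h^-1 * (f (z + h) - f z - D * h)).
  by rewrite /GRing.scale/= mulr1 (addrC h z); field.
by rewrite -cabsC cabsN lecR cabsM cabsV// mulrC ler_pdivrMr ?cabs_gt0.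
Qed.

Lemma entireP f : entire f <-> forall z, exists D, cdiff f z D.
Proof.
split=> [ef z|fD z]; first by exists ('D_1 (f : R[i]^o -> R[i]^o) (z : R[i]^o)); exact: derivable_cdiff.
by have [D /cdiff_is_derive[]] := fD z.
Qed.

Lemma entire_cst (c : R[i]) : entire (fun=> c).
Proof. by move=> z; exact: derivable_cst. Qed.

Lemma entire_id : entire (fun z : R[i] => z).
Proof. by move=> z; exact: derivable_id. Qed.

Lemma entireD f g : entire f -> entire g -> entire (fun z => f z + g z).
Proof. by move=> ef eg z; exact: derivableD. Qed.

Lemma entireM f g : entire f -> entire g -> entire (fun z => f z * g z).
Proof. by move=> ef eg z; exact: (@derivableM R[i] R[i]^o). Qed.

Lemma entireX f n : entire f -> entire (fun z => f z ^+ n).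
Proof.
move=> ef; elim: n => [|n ih]; first exact: entire_cst.
by under eq_fun do rewrite exprS; exact: entireM.
Qed.

Lemma entire_comp f g : entire f -> entire g -> entire (fun z => f (g z)).
Proof.
move=> ef eg z; apply/derivable1_diffP.
by apply: (@differentiable_comp R[i] R[i]^o R[i]^o R[i]^o g f); exact/derivable1_diffP.
Qed.

Lemma entire_cexp : entire (@cexp R).
Proof.
apply/entireP => z; exists (cexp z) => e e0.
pose K := 4 * expR 1 * expR (complex.Re z).
have K0 : 0 < K by rewrite !mulr_gt0// expR_gt0.
exists (Num.min 1 (e / K)); first by rewrite lt_min ltr01 divr_gt0.
move=> h; rewrite lt_min => /andP[h1 he].
have -> : cexp (z + h) - cexp z - cexp z * h = cexp z * (cexp h - 1 - h).
  by rewrite cexpD; ring.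
rewrite cabsM cabs_cexp.
apply: (@le_trans _ _ (expR (complex.Re z) * (4 * cabs h ^+ 2 * expR 1))).
  rewrite ler_wpM2l ?expR_ge0// (le_trans (cabs_cexp_sub1D h))//.
  by rewrite ler_wpM2l ?ler_expR ?(ltW h1)// mulr_ge0 ?sqr_ge0.
have -> : expR (complex.Re z) * (4 * cabs h ^+ 2 * expR 1) = (K * cabs h) * cabs h.
  by rewrite /K; ring.
by rewrite ler_wpM2r ?cabs_ge0// mulrC -ler_pdivlMr// ltW.
Qed.

Lemma entire_ext f g : f =1 g -> entire f -> entire g.
Proof. by move=> /funext ->. Qed.

Lemma entire_cont f z : entire f -> forall e : R, 0 < e -> exists2 d : R, 0 < d &
  forall h, cabs h < d -> cabs (f (z + h) - f z) <= e.
Proof.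
move=> /entireP/(_ z)[D fD] e e0.
have [d d0 dP] := fD 1 ltr01.
have D0 : 0 < 1 + cabs D by rewrite ltr_pwDl ?cabs_ge0.
exists (Num.min d (e / (1 + cabs D))); first by rewrite lt_min d0 divr_gt0.
move=> h; rewrite lt_min => /andP[hd he].
have -> : f (z + h) - f z = (f (z + h) - f z - D * h) + D * h by ring.
apply: (le_trans (cabsD _ _)); apply: (le_trans (lerD (dP h hd) (lexx _))).
rewrite cabsM -mulrDl mulrC -ler_pdivlMr//; exact: ltW.
Qed.

End Cdiff.

(** * Measurability of functions of a complex variable *)

Section PlaneMeasurability.
Context {R : realType}.
Implicit Types (p q : plane R).

Lemma measurable_plane_box (a b e : R) :
  measurable [set p : plane R | `|(p.1 : R) - a| < e /\ `|(p.2 : R) - b| < e].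
Proof.
rewrite (_ : [set p | _] = (ball (a : R) e) `*` (ball (b : R) e)).
  by apply: measurableX; exact: measurable_ball.
by apply/seteqP; split => -[x y] /=; rewrite /ball/= !(distrC a) !(distrC b).
Qed.

(** A superlevel set is the union of the countably many grid boxes that it
    contains: continuity puts a box of a fine enough grid around each of its
    points. *)
Lemma measurable_fun_plane_cont (phi : plane R -> R) :
  (forall p (e : R), 0 < e -> exists2 d : R, 0 < d & forall q : plane R,
     `|(q.1 : R) - p.1| < d -> `|(q.2 : R) - p.2| < d -> `|phi q - phi p| <= e) ->
  measurable_fun setT phi.
Proof.
move=> cphi; apply: (measurability _ (RGenOInfty.measurableE R)) => //.
move=> _ [_ [a ->] <-]; rewrite setTI.
(* boxes of radius 1/(n+1) around the points of the grid of mesh 1/(n+1) *)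
pose box (i : int * int * nat) := [set p : plane R |
  `|(p.1 : R) - i.1.1%:~R / i.2.+1%:R| < i.2.+1%:R^-1 /\ `|(p.2 : R) - i.1.2%:~R / i.2.+1%:R| < i.2.+1%:R^-1].
pose F (i : int * int * nat) := if `[< box i `<=` phi @^-1` `]a, +oo[%classic >] then box i else set0.
rewrite (_ : phi @^-1` _ = \bigcup_i F i); last first.
  apply/seteqP; split => [p|p [i _]]; last first.
    by rewrite /F; case: asboolP => // + bp; exact.
  rewrite /= in_itv/= andbT => ap.
  have e0 : 0 < (phi p - a) / 2 by lra.
  have [d d0 dP] := cphi p _ e0.
  have [n nd] : exists n : nat, n.+1%:R^-1 < d / 2.
    have [n _ /(_ n (leqnn n)) nd] := near_infty_natSinv_lt (PosNum (divr_gt0 d0 (ltr0Sn R 1))).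
    by exists n.
  have n0 : 0 < n.+1%:R :> R by [].
  have fl (x : R) : `|x - (Num.floor (x * n.+1%:R))%:~R / n.+1%:R| < n.+1%:R^-1.
    have -> : x - (Num.floor (x * n.+1%:R))%:~R / n.+1%:R = (x * n.+1%:R - (Num.floor (x * n.+1%:R))%:~R) / n.+1%:R.
      by rewrite mulrBl mulfK// gt_eqF.
    rewrite normrM [X in _ * X]ger0_norm ?invr_ge0// -[ltRHS]mul1r ltr_pM2r ?invr_gt0//.
    have /andP[h1 h2] := floor_itv (x * n.+1%:R).
    by rewrite intrD in h2; rewrite ger0_norm; lra.
  exists (Num.floor (p.1 * n.+1%:R), Num.floor (p.2 * n.+1%:R), n) => //.
  rewrite /F; case: asboolP => [_|]; first by split; exact: fl.
  case => q [/= q1 q2]; rewrite in_itv/= andbT.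
  have h1 := fl p.1; have h2 := fl p.2.
  have tri (x y z : R) : `|x - z| < n.+1%:R^-1 -> `|y - z| < n.+1%:R^-1 -> `|x - y| < d.
    by move: nd; move: (n.+1%:R^-1) => t td; rewrite !ltr_norml => /andP[? ?] /andP[? ?]; apply/andP; split; lra.
  have : `|phi q - phi p| <= (phi p - a) / 2.
    by apply: dP; [exact: tri q1 h1|exact: tri q2 h2].
  by rewrite ler_norml => /andP[]; lra.
apply: countable_bigcupT_measurable => // i; rewrite /F; case: asboolP => // _.
exact: measurable_plane_box.
Qed.

Definition cmeas (h : plane R -> R[i]) :=
  measurable_fun setT (fun p => complex.Re (h p)) /\
  measurable_fun setT (fun p => complex.Im (h p)).

Lemma cabs_pt_lt p q d : `|(q.1 : R) - p.1| < d / 2 -> `|(q.2 : R) - p.2| < d / 2 ->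
  cabs (pt q - pt p) < d.
Proof.
move=> h1 h2; apply: (le_lt_trans (cabs_le_ReIm _)).
by rewrite /pt/=; lra.
Qed.

Lemma entire_cmeas (f : R[i] -> R[i]) : entire f -> cmeas (fun p => f (pt p)).
Proof.
move=> ef; split; apply: measurable_fun_plane_cont => p e e0;
  have [d d0 dP] := entire_cont (pt p) ef e0;
  (exists (d / 2); first exact: divr_gt0) => q h1 h2;
  have := dP _ (cabs_pt_lt h1 h2); rewrite subrKC => h.
  by apply: le_trans h; rewrite -ReN -ReD Re_le_cabs.
by apply: le_trans h; rewrite -ImN -ImD Im_le_cabs.
Qed.

Lemma cmeasM (h k : plane R -> R[i]) : cmeas h -> cmeas k -> cmeas (fun p => h p * k p).
Proof.
move=> [h1 h2] [k1 k2]; split.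
  under eq_fun do rewrite ReM.
  by apply: measurable_funB; apply: measurable_funM.
under eq_fun do rewrite ImM.
by apply: measurable_funD; apply: measurable_funM.
Qed.

Lemma cmeasJ (h : plane R -> R[i]) : cmeas h -> cmeas (fun p => (h p)^*).
Proof.
move=> [h1 h2]; split; first by under eq_fun do rewrite ReJ.
by under eq_fun do rewrite ImJ; apply: measurableT_comp.
Qed.

Lemma cmeas_real (h : plane R -> R) : measurable_fun setT h -> cmeas (fun p => (h p)%:C).
Proof. by move=> mh; split => //=; exact: measurable_cst. Qed.

Lemma measurable_cabs (h : plane R -> R[i]) : cmeas h ->
  measurable_fun setT (fun p => cabs (h p)).
Proof.
move=> [h1 h2]; under eq_fun do rewrite cabsE.
apply: (measurableT_comp (f := @Num.sqrt R)).
  exact: (continuous_measurable_fun (@sqrt_continuous R)).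
by apply: measurable_funD; apply: measurable_funX.
Qed.

Lemma measurable_omega : measurable_fun setT (fun p : plane R => omega (pt p)).
Proof.
rewrite /omega; apply: measurable_funM; first exact: measurable_cst.
apply: measurableT_comp; first exact: measurable_expR.
apply: measurableT_comp => //; apply: measurable_funX.
by apply: measurable_cabs; apply: (@entire_cmeas (fun z => z)); exact: entire_id.
Qed.

End PlaneMeasurability.

(** * Invariance of area under translations and rotations *)

Section AreaInvariance.
Context {R : realType}.
Local Notation lam := (@lebesgue_measure R).

Lemma measurable_shift (c : R) :
  measurable_fun setT (fun x : measurableTypeR R => (x + c : measurableTypeR R)).
Proof. by apply: measurable_funD => //; exact: measurable_cst. Qed.

(** The two measures agree on half-open intervals. *)
Lemma lebesgue_shift (c : R) (A : set (measurableTypeR R)) : measurable A ->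
  pushforward lam (fun x : measurableTypeR R => (x + c : measurableTypeR R)) A = lam A.
Proof.
move=> mA.
pose mu : {measure set (measurableTypeR R) -> \bar R} :=
  measure_function_pushforward__canonical__measure_function_Measure lam (measurable_shift c).
rewrite [RHS](@lebesgue_measure_unique R mu)// => X /ocitvP[->|[[a b] /= ab ->]].
  by rewrite !measure0.
rewrite /mu/= /pushforward/= (_ : _ @^-1` _ = `]a - c, b - c]%classic).
  by rewrite !lebesgue_measure_itv/= !lte_fin ltrD2r; case: ifP => // _;
    rewrite -!EFinD; congr (_%:E); ring.
apply/seteqP; split => x /=; rewrite !in_itv/= => /andP[]; lra.
Qed.

Lemma ge0_integral_shift (c : R) (f : measurableTypeR R -> \bar R) :
  measurable_fun setT f -> (forall x, 0 <= f x)%E ->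
  (\int[lam]_x f (x + c)%R = \int[lam]_x f x)%E.
Proof.
move=> mf f0.
have := @ge0_integral_pushforward _ _ _ _ R _ (measurable_shift c) lam setT f measurableT mf (fun x _ => f0 x).
rewrite preimage_setT => <-.
apply: eq_measure_integral => [|ms A mA _]; first exact: measurable_shift.
exact: (lebesgue_shift c mA).
Qed.

(** Stated for nonnegative functions, to which Tonelli's theorem applies directly;
    [area_preserving_integral] extends it to signed ones. *)
Definition area_preserving (S : plane R -> plane R) :=
  measurable_fun setT S /\
  forall f : plane R -> \bar R, measurable_fun setT f -> (forall p, 0 <= f p)%E ->
    (\int[area]_p f (S p) = \int[area]_p f p)%E.

Lemma area_preserving_comp S S' :
  area_preserving S -> area_preserving S' -> area_preserving (S \o S').
Proof.
move=> [mS iS] [mS' iS']; split; first exact: measurableT_comp.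
move=> f mf f0; rewrite -(iS f)// -(iS' (f \o S)) => [//||p]; last exact: f0.
exact: measurableT_comp.
Qed.

Lemma area_preserving_integral S (f : plane R -> \bar R) :
  area_preserving S -> measurable_fun setT f ->
  (\int[area]_p f (S p) = \int[area]_p f p)%E.
Proof.
move=> [mS iS] mf; rewrite integralE [RHS]integralE.
rewrite -[X in _ = (X - _)%E](iS (f^\+)%E)//; last exact: measurable_funepos.
rewrite -[X in _ = (_ - X)%E](iS (f^\-)%E)//; last exact: measurable_funeneg.
by rewrite -/(f \o S) funepos_comp funeneg_comp.
Qed.

(** On each vertical line the shear is a translation. *)
Lemma area_preserving_yshear (a b : R) :
  area_preserving (fun p : plane R => ((p.1, p.2 + (a * p.1 + b)) : plane R)).
Proof.
have mS : measurable_fun setT (fun p : plane R => ((p.1, p.2 + (a * p.1 + b)) : plane R)).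
  apply/measurable_fun_pairP; split => /=; first exact: measurable_fst.
  apply: measurable_funD; first exact: measurable_snd.
  apply: measurable_funD; last exact: measurable_cst.
  apply: measurable_funM; [exact: measurable_cst|exact: measurable_fst].
split=> // f mf f0.
rewrite /area fubini_tonelli1//; last exact: measurableT_comp.
rewrite fubini_tonelli1//; apply: eq_integral => x _.
rewrite /fubini_F/= (@ge0_integral_shift _ (fun y => f (x, y)))//.
by apply: measurableT_comp => //; exact: pair1_measurable.
Qed.

Lemma area_preserving_xshear (a b : R) :
  area_preserving (fun p : plane R => ((p.1 + (a * p.2 + b), p.2) : plane R)).
Proof.
have mS : measurable_fun setT (fun p : plane R => ((p.1 + (a * p.2 + b), p.2) : plane R)).
  apply/measurable_fun_pairP; split => /=; last exact: measurable_snd.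
  apply: measurable_funD; first exact: measurable_fst.
  apply: measurable_funD; last exact: measurable_cst.
  apply: measurable_funM; [exact: measurable_cst|exact: measurable_snd].
split=> // f mf f0.
rewrite /area fubini_tonelli2//; last exact: measurableT_comp.
rewrite fubini_tonelli2//; apply: eq_integral => y _.
rewrite /fubini_G/= (@ge0_integral_shift _ (fun x => f (x, y)))//.
by apply: measurableT_comp => //; exact: pair2_measurable.
Qed.

Definition pt_inv (z : R[i]) : plane R := (complex.Re z, complex.Im z).

Lemma ptK (z : R[i]) : pt (pt_inv z) = z.
Proof. by case: z. Qed.

Lemma area_preserving_translation (z : R[i]) :
  area_preserving (fun p => pt_inv (pt p + z)).
Proof.
have := area_preserving_comp (area_preserving_xshear 0 (complex.Re z)) (area_preserving_yshear 0 (complex.Im z)).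
congr area_preserving; apply/funext => -[x y]; rewrite /pt_inv /pt/= !mul0r !add0r.
by case: z.
Qed.

(** A rotation is a product of three shears, with coefficients built from the
    tangent of the half angle.  The half turn, where that tangent is infinite,
    is the square of the quarter turn. *)
Lemma area_preserving_rotation (z : R[i]) : cabs z = 1 ->
  area_preserving (fun p => pt_inv (z * pt p)).
Proof.
wlog : z / complex.Re z != -1.
  move=> H z1; have [zN1|] := eqVneq (complex.Re z) (-1); last by move=> /H; apply.
  (* the half turn *)
  have zE : z = -1.
    have := cabs_sqr z; rewrite z1 zN1 => h; apply: complex_ext => //=.
    by apply/eqP; rewrite oppr0 -sqrf_eq0; apply/eqP; lra.
  have i1 : cabs ('i%C : R[i]) = 1 by rewrite cabsE/= expr0n expr1n add0r sqrtr1.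
  have i2 : complex.Re ('i%C : R[i]) != -1 by rewrite /= eq_sym oppr_eq0 oner_eq0.
  have := area_preserving_comp (H _ i2 i1) (H _ i2 i1).
  congr area_preserving; apply/funext => p /=; rewrite ptK mulrA zE.
  by rewrite -expr2 sqr_i.
move=> zN1 z1; have := cabs_sqr z; rewrite z1.
case: z zN1 {z1} => c s /= cN1 cs.
have c1 : 1 + c != 0 by rewrite addrC addr_eq0.
(* tangent of the half angle *)
pose t := s / (1 + c).
have := area_preserving_comp (area_preserving_xshear (- t) 0)
  (area_preserving_comp (area_preserving_yshear s 0) (area_preserving_xshear (- t) 0)).
congr area_preserving; apply/funext => -[x y]; rewrite /pt_inv /pt/= !addr0.
have st : s * t = 1 - c.
  rewrite /t mulrA -expr2 -(mulfK c1 (1 - c)); congr (_ / _); lra.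
congr (_, _).
  have tE : t * (1 + c) = s by rewrite /t mulfVK.
  have -> : x + - t * y + - t * (y + s * (x + - t * y)) =
    x * (1 - s * t) - t * (1 + (1 - s * t)) * y by ring.
  by rewrite st opprB !(addrCA 1) addrA subrKC; rewrite -tE; ring.
have -> : y + s * (x + - t * y) = s * x + (1 - s * t) * y by ring.
by rewrite st; ring.
Qed.

End AreaInvariance.

(** * Integrals over segments *)

Section SegmentIntegral.
Context {R : realType}.
Local Notation lam := (@lebesgue_measure R).
Implicit Types (f g : R -> R) (a b c : R).

Definition segint a b f : R := \int[lam]_(x in `[a, b]) f x.

Lemma eps_continuous f :
  (forall x e : R, 0 < e -> exists2 d : R, 0 < d & forall y, `|y - x| < d -> `|f y - f x| <= e) ->
  continuous f.
Proof.
move=> cf x; apply/cvgrPdist_le => /= e e0; have [d d0 dP] := cf x e e0.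
near=> y; rewrite distrC; apply: dP; rewrite distrC; near: y.
by apply: cvgr_dist_lt.
Unshelve. all: by end_near. Qed.

Lemma continuous_integrable_segment f a b : continuous f -> lam.-integrable `[a, b] (EFin \o f).
Proof.
move=> cf; apply: continuous_compact_integrable; first exact: segment_compact.
exact: continuous_subspaceT.
Qed.

Lemma segint_split f a b c : continuous f -> a <= c -> c <= b ->
  segint a b f = segint a c f + segint c b f.
Proof.
move=> cf ac cb; rewrite /segint.
have := @Rintegral_itvB R f (BLeft a) (BRight b) c (continuous_integrable_segment _ _ cf).
rewrite !bnd_simp => /(_ ac cb) h.
rewrite -[X in _ = _ + X]Rintegral_itv_obnd_cbnd.
  by rewrite -h addrC subrK.
apply: integrableS (continuous_integrable_segment a b cf) => //.
by apply: subset_itvr; rewrite bnd_simp.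
Qed.

Lemma segintD f g a b : continuous f -> continuous g ->
  segint a b (fun x => f x + g x) = segint a b f + segint a b g.
Proof. by move=> cf cg; apply: RintegralD => //; exact: continuous_integrable_segment. Qed.

Lemma segintB f g a b : continuous f -> continuous g ->
  segint a b (fun x => f x - g x) = segint a b f - segint a b g.
Proof. by move=> cf cg; apply: RintegralB => //; exact: continuous_integrable_segment. Qed.

Lemma segint_cst a b (r : R) : a <= b -> segint a b (fun=> r) = r * (b - a).
Proof.
move=> ab; rewrite /segint Rintegral_cst//= lebesgue_measure_itv/= lte_fin.
case: ltP => [_|ba]; first by rewrite -EFinB.
by have -> : a = b; [lra|rewrite subrr].
Qed.

Lemma segint_bound f a b (M : R) : a <= b -> continuous f ->
  (forall x, a <= x <= b -> `|f x| <= M) -> `|segint a b f| <= M * (b - a).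
Proof.
move=> ab cf fM; rewrite -segint_cst//.
apply: (le_trans (le_normr_Rintegral _ (continuous_integrable_segment a b cf))) => //.
apply: le_Rintegral => //.
- by apply: continuous_integrable_segment => x; apply: continuous_comp; [exact: cf|exact: norm_continuous].
- by apply: continuous_integrable_segment => x; exact: cvg_cst.
Qed.

End SegmentIntegral.

(** * Circulation of closed forms around squares *)

Section Green.
Context {R : realType}.
Implicit Types (P Q : R -> R -> R) (u v l : R).

(** [P dx + Q dy] is differentiable at every point, with the closedness
    condition [dP/dy = dQ/dx] expressed by the shared coefficient [k]; nothing
    is assumed about the continuity of the partial derivatives. *)
Definition closed_form P Q := forall x0 y0, exists a k d, forall e : R, 0 < e ->
  exists2 dl : R, 0 < dl & forall s t, `|s| < dl -> `|t| < dl ->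
    `|P (x0 + s) (y0 + t) - P x0 y0 - a * s - k * t| <= e * (`|s| + `|t|) /\
    `|Q (x0 + s) (y0 + t) - Q x0 y0 - k * s - d * t| <= e * (`|s| + `|t|).

Lemma closed_form_cont P Q : closed_form P Q ->
  [/\ forall y, continuous (P^~ y), forall y, continuous (Q^~ y), forall x, continuous (P x)
    & forall x, continuous (Q x)].
Proof.
move=> cPQ.
have gen x0 y0 e : 0 < e -> exists2 dl : R, 0 < dl & forall s t, `|s| < dl -> `|t| < dl ->
    `|P (x0 + s) (y0 + t) - P x0 y0| <= e /\ `|Q (x0 + s) (y0 + t) - Q x0 y0| <= e.
  move=> e0; have [a [k [d /(_ 1 ltr01)[dl dl0 dP]]]] := cPQ x0 y0.
  pose K := 1 + `|a| + `|k| + `|d|.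
  have K0 : 0 < K by rewrite /K !ltr_pwDl.
  have e0' : 0 < e / (2 * K) by rewrite divr_gt0// mulr_gt0.
  exists (Num.min dl (e / (2 * K))); first by rewrite lt_min dl0.
  move=> s t; rewrite !lt_min => /andP[s1 s2] /andP[t1 t2].
  have [h1 h2] := dP s t s1 t1.
  have kK : 0 <= `|k| /\ 0 <= `|a| /\ 0 <= `|d| by rewrite !normr_ge0.
  have bd (b c : R) : `|b| + 1 <= K -> `|c| + 1 <= K ->
      1 * (`|s| + `|t|) + (`|b * s| + `|c * t|) <= e.
    move=> bK cK; rewrite !normrM mul1r.
    apply: (@le_trans _ _ (K * (e / (2 * K)) + K * (e / (2 * K)))); last first.
      by rewrite le_eqVlt; apply/orP; left; apply/eqP; field; rewrite gt_eqF.
    have -> : `|s| + `|t| + (`|b| * `|s| + `|c| * `|t|) = (`|b| + 1) * `|s| + (`|c| + 1) * `|t| by ring.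
    by apply: lerD; apply: ler_pM => //; rewrite ?addr_ge0// ltW.
  split.
    have -> : P (x0 + s) (y0 + t) - P x0 y0 = (P (x0 + s) (y0 + t) - P x0 y0 - a * s - k * t) + (a * s + k * t) by ring.
    apply: (le_trans (ler_normD _ _)); apply: (le_trans (lerD h1 (ler_normD _ _))).
    by apply: bd; rewrite /K; lra.
  have -> : Q (x0 + s) (y0 + t) - Q x0 y0 = (Q (x0 + s) (y0 + t) - Q x0 y0 - k * s - d * t) + (k * s + d * t) by ring.
  apply: (le_trans (ler_normD _ _)); apply: (le_trans (lerD h2 (ler_normD _ _))).
  by apply: bd; rewrite /K; lra.
split=> z; apply: eps_continuous => w e e0.
- have [d d0 dP] := gen w z e e0; exists d => // y yw.
  by have := dP _ 0 yw; rewrite normr0 addr0 subrKC => /(_ d0)[].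
- have [d d0 dP] := gen w z e e0; exists d => // y yw.
  by have := dP _ 0 yw; rewrite normr0 addr0 subrKC => /(_ d0)[].
- have [d d0 dP] := gen z w e e0; exists d => // y yw.
  by have := dP 0 _ _ yw; rewrite normr0 addr0 subrKC => /(_ d0)[].
- have [d d0 dP] := gen z w e e0; exists d => // y yw.
  by have := dP 0 _ _ yw; rewrite normr0 addr0 subrKC => /(_ d0)[].
Qed.

Definition circulation P Q u v l :=
  segint u (u + l) (P^~ v) - segint u (u + l) (P^~ (v + l)) +
  (segint v (v + l) (Q (u + l)) - segint v (v + l) (Q u)).

Lemma circulation_quarter P Q u v l : closed_form P Q -> 0 <= l ->
  circulation P Q u v (l + l) =
    circulation P Q u v l + circulation P Q (u + l) v l +
    circulation P Q u (v + l) l + circulation P Q (u + l) (v + l) l.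
Proof.
move=> /closed_form_cont[cP1 cQ1 cP2 cQ2] l0; rewrite /circulation !addrA.
have ul : u <= u + l by lra.
have ul2 : u + l <= u + l + l by lra.
have vl : v <= v + l by lra.
have vl2 : v + l <= v + l + l by lra.
rewrite !(@segint_split _ _ u (u + l + l) (u + l))//.
rewrite !(@segint_split _ _ v (v + l + l) (v + l))//.
by ring.
Qed.

(** The affine part of a closed form is exact, so it does not contribute; only
    the differentiability remainder does, and it is small compared with [l]
    along the four sides of length [l]. *)
Lemma circulation_small P Q x0 y0 (e : R) : closed_form P Q -> 0 < e ->
  exists2 dl : R, 0 < dl & forall u v l, 0 <= l -> l < dl ->
    u <= x0 <= u + l -> v <= y0 <= v + l -> `|circulation P Q u v l| <= e * l ^+ 2.
Proof.
move=> cPQ e0; have [cP1 cQ1 cP2 cQ2] := closed_form_cont cPQ.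
have [a [k [d /(_ (e / 8))[|dl dl0 dP]]]] := cPQ x0 y0; first by rewrite divr_gt0.
exists dl => // u v l l0 ldl /andP[u1 u2] /andP[v1 v2].
have near x y : u <= x <= u + l -> v <= y <= v + l ->
    `|P x y - P x0 y0 - a * (x - x0) - k * (y - y0)| <= e / 4 * l /\
    `|Q x y - Q x0 y0 - k * (x - x0) - d * (y - y0)| <= e / 4 * l.
  move=> /andP[x1 x2] /andP[y1 y2].
  have xl : `|x - x0| <= l by rewrite ler_norml; apply/andP; split; lra.
  have yl : `|y - y0| <= l by rewrite ler_norml; apply/andP; split; lra.
  have := dP _ _ (le_lt_trans xl ldl) (le_lt_trans yl ldl); rewrite !subrKC => -[h1 h2].
  have : e / 8 * (`|x - x0| + `|y - y0|) <= e / 4 * l.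
    rewrite (_ : e / 4 * l = e / 8 * (l + l)); last by field.
    by rewrite ler_wpM2l ?lerD// ltW// divr_gt0.
  by split; lra.
have vvl : v <= v <= v + l by apply/andP; split; lra.
have vlvl : v <= v + l <= v + l by apply/andP; split; lra.
have uul : u <= u <= u + l by apply/andP; split; lra.
have ulul : u <= u + l <= u + l by apply/andP; split; lra.
have cst c : continuous (fun _ : R => c : R) by move=> z; exact: cvg_cst.
have cP y1 y2 : continuous (fun x => P x y1 - P x y2).
  by move=> z; apply: cvgB; [exact: cP1|exact: cP1].
have cQ x1 x2 : continuous (fun y => Q x1 y - Q x2 y).
  by move=> z; apply: cvgB; [exact: cQ2|exact: cQ2].
(* the affine parts contribute the constants - k l and k l to the integrands *)
have -> : circulation P Q u v l =
   segint u (u + l) (fun x => (P x v - P x (v + l)) + k * l) +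
   segint v (v + l) (fun y => (Q (u + l) y - Q u y) - k * l).
  rewrite segintD// segintB// segintB// segintB// !segint_cst; [|lra|lra].
  by rewrite /circulation; ring.
apply: (le_trans (ler_normD _ _)).
have b1 : `|segint u (u + l) (fun x => (P x v - P x (v + l)) + k * l)| <= e / 2 * l * (u + l - u).
  apply: segint_bound; [lra| |].
    by move=> z; apply: cvgD; [exact: cP|exact: cst].
  move=> x hx; have [+ _] := near x v hx vvl; have [+ _] := near x (v + l) hx vlvl.
  rewrite !ler_norml => /andP[? ?] /andP[? ?]; apply/andP; split; lra.
have b2 : `|segint v (v + l) (fun y => (Q (u + l) y - Q u y) - k * l)| <= e / 2 * l * (v + l - v).
  apply: segint_bound; [lra| |].
    by move=> z; apply: cvgB; [exact: cQ|exact: cst].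
  move=> x hx; have [_ +] := near u x uul hx; have [_ +] := near (u + l) x ulul hx.
  rewrite !ler_norml => /andP[? ?] /andP[? ?]; apply/andP; split; lra.
apply: (le_trans (lerD b1 b2)); rewrite le_eqVlt; apply/orP; left; apply/eqP.
by field.
Qed.

Section Bisection.
Context (P Q : R -> R -> R) (e u0 v0 L : R).
Context (cPQ : closed_form P Q) (e0 : 0 < e) (L0 : 0 <= L).
Let bad u v l := e * l ^+ 2 < `|circulation P Q u v l|.

Let step l (p : R * R) : R * R :=
  if bad p.1 p.2 l then p else if bad (p.1 + l) p.2 l then (p.1 + l, p.2)
  else if bad p.1 (p.2 + l) l then (p.1, p.2 + l) else (p.1 + l, p.2 + l).

Let side n : R := L / 2 ^+ n.

Let side2 n : side n.+1 + side n.+1 = side n.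
Proof. by rewrite /side exprS; field; rewrite expf_neq0. Qed.

Let side_ge0 n : 0 <= side n.
Proof. by rewrite divr_ge0// exprn_ge0. Qed.

Let corner := fix F n := if n is m.+1 then step (side m.+1) (F m) else (u0, v0).

(** If a square violates the bound [e l^2], then so does one of its quarters,
    because the circulation is additive and the four quarters have the same
    total bound. *)
Let corner_bad n : bad u0 v0 L -> bad (corner n).1 (corner n).2 (side n).
Proof.
move=> b0; elim: n => [|n ih] /=; first by rewrite /side expr0 divr1.
rewrite /step; case: ifPn => //= b1; case: ifPn => //= b2; case: ifPn => //= b3.
move: ih b1 b2 b3; rewrite /bad -side2 circulation_quarter// -!leNgt.
set l := side n.+1; set c1 := circulation _ _ _ _ _; set c2 := circulation _ _ _ _ _.
set c3 := circulation _ _ _ _ _; set c4 := circulation _ _ _ _ _ => h b1 b2 b3.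
have t : `|c1 + c2 + c3 + c4| <= `|c1| + `|c2| + `|c3| + `|c4|.
  by do 2 (apply: (le_trans (ler_normD _ _)); rewrite lerD2r); exact: ler_normD.
have : e * (l + l) ^+ 2 = 4 * (e * l ^+ 2) by ring.
by lra.
Qed.

Let corner_nest n : [/\ (corner n).1 <= (corner n.+1).1, (corner n).2 <= (corner n.+1).2,
  (corner n.+1).1 + side n.+1 <= (corner n).1 + side n &
  (corner n.+1).2 + side n.+1 <= (corner n).2 + side n].
Proof.
rewrite -(side2 n) /= /step; have := side_ge0 n.+1; set l := side n.+1 => l0.
by repeat (case: ifP => _ /=); split; lra.
Qed.

Let nested_limit (w : nat -> R) : (forall n, w n <= w n.+1) ->
  (forall n, w n.+1 + side n.+1 <= w n + side n) ->
  exists x, forall n, w n <= x <= w n + side n.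
Proof.
move=> w1 w2.
have nd : {homo w : m n / (m <= n)%N >-> m <= n}.
  exact: (homo_leq (@lexx _ R) (@le_trans _ R) w1).
have ni : {homo (fun n => w n + side n) : m n / (m <= n)%N >-> n <= m}.
  by apply: (homo_leq (r := fun x y : R => y <= x)) => // x y z xy yz; exact: le_trans yz xy.
have ub m n : w m <= w n + side n.
  have [mn|nm] := leqP m n.
    by apply: (le_trans (nd _ _ mn)); rewrite lerDl.
  by apply: (le_trans _ (ni _ _ (ltnW nm))); rewrite lerDl.
exists (sup (range w)) => n; apply/andP; split.
  apply: sup_upper_bound; last by exists n.
  by split; [exists (w 0%N); exists 0%N|exists (w 0%N + side 0%N) => _ [m _ <-]].
by apply: ge_sup; [exists (w 0%N); exists 0%N|move=> _ [m _ <-]].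
Qed.

(** Otherwise nested bad squares shrink to a point, where [circulation_small]
    contradicts them. *)
Lemma circulation_le : `|circulation P Q u0 v0 L| <= e * L ^+ 2.
Proof.
rewrite leNgt; apply/negP => b0.
have [x0 x0P] := @nested_limit (fun n => (corner n).1)
  (fun n => let: And4 h _ _ _ := corner_nest n in h) (fun n => let: And4 _ _ h _ := corner_nest n in h).
have [y0 y0P] := @nested_limit (fun n => (corner n).2)
  (fun n => let: And4 _ h _ _ := corner_nest n in h) (fun n => let: And4 _ _ _ h := corner_nest n in h).
have [dl dl0 dP] := circulation_small x0 y0 cPQ e0.
have [n nL] : exists n, side n < dl.
  pose n := Num.bound (L / dl).
  have h : L / dl < n%:R by apply: archi_boundP; rewrite divr_ge0// ltW.
  exists n; rewrite /side ltr_pdivrMr ?exprn_gt0//.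
  rewrite ltr_pdivrMr// mulrC in h; apply: (lt_le_trans h).
  by rewrite ler_wpM2l ?(ltW dl0)// -natrX ler_nat ltnW// ltn_expl.
have := dP _ _ _ (side_ge0 n) nL (x0P n) (y0P n).
by rewrite leNgt => /negP; apply; exact: corner_bad.
Qed.

End Bisection.

Lemma circulation_eq0 P Q u v l : closed_form P Q -> 0 <= l -> circulation P Q u v l = 0.
Proof.
move=> cPQ l0; apply/eqP; rewrite -normr_eq0 eq_le normr_ge0 andbT.
apply/ler_addgt0Pl => e e0; rewrite addr0.
have l2 : 0 < l ^+ 2 + 1 by rewrite ltr_wpDl ?sqr_ge0.
have h := circulation_le u v cPQ (divr_gt0 e0 l2) l0; apply: (le_trans h).
by rewrite mulrAC ler_pdivrMr// ler_wpM2l ?(ltW e0)//; lra.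
Qed.

End Green.

(** * Means over circles *)

Section CircleMean.
Context {R : realType}.
Implicit Types (f : R[i] -> R[i]) (u : R[i]).

(** By the Cauchy-Riemann equations, [Im f dx + Re f dy] is closed. *)
Lemma entire_polar_closed_form f : entire f ->
  closed_form (fun s t => complex.Im (f (s +i* t))) (fun s t => complex.Re (f (s +i* t))).
Proof.
move=> /entireP ef x0 y0; have [[p q] fD] := ef (x0 +i* y0).
exists q, p, (- q) => e e0; have [d d0 dP] := fD e e0.
exists (d / 2); first exact: divr_gt0.
move=> s t sd td; have st : cabs (s +i* t) <= `|s| + `|t| := cabs_le_ReIm _.
have /dP h : cabs (s +i* t) < d by lra.
have {}h : cabs (f ((x0 + s) +i* (y0 + t)) - f (x0 +i* y0) - (p +i* q) * (s +i* t)) <= e * (`|s| + `|t|).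
  by apply: le_trans h _; rewrite ler_wpM2l// ltW.
split; apply: le_trans h.
  apply: le_trans (Im_le_cabs _); rewrite !ImD !ImN ImM/=.
  by rewrite (_ : _ - _ - q * s - p * t = complex.Im (f ((x0 + s) +i* (y0 + t))) - complex.Im (f (x0 +i* y0)) - (p * t + q * s)); last ring.
apply: le_trans (Re_le_cabs _); rewrite !ReD !ReN ReM/=.
by rewrite (_ : _ - _ - p * s - - q * t = complex.Re (f ((x0 + s) +i* (y0 + t))) - complex.Re (f (x0 +i* y0)) - (p * s - q * t)); last ring.
Qed.

(** In logarithmic coordinates [s + it] the circles are the vertical segments of
    height [2 pi].  The horizontal sides of a square of side [2 pi] cancel by
    periodicity, so the means for [s] and [s + 2 pi] agree; moving [s] to minus
    infinity in such steps shrinks the circle to the origin. *)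
Lemma circle_mean_Re f u : entire f ->
  segint 0 (pi *+ 2) (fun t : R => complex.Re (f (cexp (0 +i* t) * u))) = pi *+ 2 * complex.Re (f 0).
Proof.
move=> ef; pose H z := f (cexp z * u).
have eH : entire H.
  by apply: (entire_comp ef); apply: entireM; [exact: entire_cexp|exact: entire_cst].
have cf := entire_polar_closed_form eH; have [_ _ _ cQ] := closed_form_cont cf.
pose M s := segint 0 (pi *+ 2) (fun t : R => complex.Re (H (s +i* t))).
have pi0 : 0 < pi *+ 2 :> R by rewrite mulrn_wgt0// pi_gt0.
have Mper s : M (s + pi *+ 2) = M s.
  have := circulation_eq0 s 0 cf (ltW pi0); rewrite /circulation add0r.
  rewrite (_ : segint _ _ _ - segint _ _ _ = 0) ?add0r => [/eqP|].
    by rewrite subr_eq0 => /eqP.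
  rewrite (_ : (fun x => complex.Im (H (x +i* (pi *+ 2)))) = (fun x => complex.Im (H (x +i* 0)))) ?subrr//.
  by apply/funext => x; rewrite /H !cexpE/= cos2pi sin2pi cos0 sin0.
have Mn n : M 0 = M (- (pi *+ 2 * n%:R)).
  elim: n => [|n ->]; first by rewrite mulr0 oppr0.
  by rewrite -(Mper (- (pi *+ 2 * n.+1%:R))); congr M; rewrite -natr1; ring.
apply/eqP; rewrite -/(M 0) -subr_eq0 -normr_eq0 eq_le normr_ge0 andbT.
apply/ler_addgt0Pl => e e0; rewrite addr0.
have [d d0 dP] := entire_cont 0 ef (divr_gt0 e0 pi0).
(* n steps bring the whole circle within distance d of the origin *)
have [n nd] : exists n : nat, cabs u < d * n%:R.
  exists (Num.bound (cabs u / d)); rewrite mulrC -ltr_pdivrMr//.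
  by apply: archi_boundP; rewrite divr_ge0 ?cabs_ge0// ltW.
have ex : n%:R <= expR (pi *+ 2 * n%:R) :> R.
  apply: le_trans (expR_ge1Dx _); rewrite ler_wpDl// ler_peMl//.
  by rewrite mulr2n; have := @pi_ge2 R; lra.
have small t : cabs (cexp ((- (pi *+ 2 * n%:R)) +i* t) * u) < d.
  rewrite cabsM cabs_cexp/= expRN mulrC ltr_pdivrMr ?expR_gt0//.
  by apply: (lt_le_trans nd); rewrite ler_wpM2l// ltW.
rewrite (Mn n) /M (_ : pi *+ 2 * complex.Re (f 0) = segint 0 (pi *+ 2) (fun=> complex.Re (f 0))); last first.
  by rewrite segint_cst ?(ltW pi0)// subr0 mulrC.
rewrite -segintB//; last by move=> z; exact: cvg_cst.
rewrite -[leRHS](@divfK _ (pi *+ 2)) ?gt_eqF// -[X in _ <= _ * X]subr0.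
apply: segint_bound; first exact: ltW.
  by move=> z; apply: cvgB; [exact: cQ|exact: cvg_cst].
move=> t _; have := dP _ (small t); rewrite add0r; apply: le_trans.
by rewrite -ReN -ReD Re_le_cabs.
Qed.

End CircleMean.

(** * Complex-valued integrals over the plane *)

Section ComplexIntegral.
Context {R : realType}.
Implicit Types (h k : plane R -> R[i]).

Definition cint h : R[i] :=
  (\int[area]_p complex.Re (h p)) +i* (\int[area]_p complex.Im (h p)).

Definition cintegrable h :=
  area.-integrable setT (fun p => (complex.Re (h p))%:E) /\
  area.-integrable setT (fun p => (complex.Im (h p))%:E).

Lemma integrable_comb (a b : R) (f g f' : plane R -> R) :
  area.-integrable setT (fun p => (f p)%:E) -> area.-integrable setT (fun p => (g p)%:E) ->
  area.-integrable setT (fun p => (f' p)%:E) ->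
  area.-integrable setT (fun p => (a * f p + b * g p + f' p)%:E) /\
  \int[area]_p (a * f p + b * g p + f' p) =
   a * \int[area]_p f p + b * \int[area]_p g p + \int[area]_p f' p.
Proof.
move=> fi gi fi'.
have afi : area.-integrable setT (fun p => (a * f p)%:E).
  by under eq_fun do rewrite EFinM; exact: integrableZl.
have bgi : area.-integrable setT (fun p => (b * g p)%:E).
  by under eq_fun do rewrite EFinM; exact: integrableZl.
have abi : area.-integrable setT (fun p => (a * f p + b * g p)%:E).
  by under eq_fun do rewrite EFinD; exact: integrableD.
split; first by under eq_fun do rewrite EFinD; exact: integrableD.
by rewrite RintegralD// RintegralD// !RintegralZl.
Qed.

Lemma cint_lin (a : R[i]) h k : cintegrable h -> cintegrable k ->
  cintegrable (fun p => a * h p + k p) /\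
  cint (fun p => a * h p + k p) = a * cint h + cint k.
Proof.
move=> [h1 h2] [k1 k2].
have [r1 r2] := integrable_comb (complex.Re a) (- complex.Im a) h1 h2 k1.
have [i1 i2] := integrable_comb (complex.Re a) (complex.Im a) h2 h1 k2.
have E1 : (fun p => complex.Re (a * h p + k p)) =
  (fun p => complex.Re a * complex.Re (h p) + - complex.Im a * complex.Im (h p) + complex.Re (k p)).
  by apply/funext => p; rewrite ReD ReM mulNr.
have E2 : (fun p => complex.Im (a * h p + k p)) =
  (fun p => complex.Re a * complex.Im (h p) + complex.Im a * complex.Re (h p) + complex.Im (k p)).
  by apply/funext => p; rewrite ImD ImM.
split.
  by split; [rewrite (_ : (fun p => _) = EFin \o (fun p => complex.Re (a * h p + k p)))// E1
   |rewrite (_ : (fun p => _) = EFin \o (fun p => complex.Im (a * h p + k p)))// E2].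
apply: complex_ext; rewrite ?ReD ?ImD ?ReM ?ImM /cint/=.
  by rewrite E1 r2 mulNr.
by rewrite E2 i2.
Qed.

Lemma cintJ h : cintegrable h -> cint (fun p => (h p)^*) = (cint h)^*.
Proof.
move=> [h1 h2]; apply: complex_ext; rewrite ?ReJ ?ImJ /cint/=.
  by apply: eq_Rintegral => p _; rewrite ReJ.
rewrite -mulN1r -RintegralZl//.
by apply: eq_Rintegral => p _; rewrite ImJ mulN1r.
Qed.

Lemma cintegrable_le h (b : plane R -> R) : cmeas h ->
  area.-integrable setT (fun p => (b p)%:E) -> (forall p, cabs (h p) <= b p) -> cintegrable h.
Proof.
move=> [h1 h2] bi hb; split; apply: le_integrable bi => //.
- exact/measurable_EFinP.
- by move=> p _; rewrite !abse_EFin lee_fin (le_trans (Re_le_cabs _))// (le_trans (hb p)) ?ler_norm.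
- exact/measurable_EFinP.
- by move=> p _; rewrite !abse_EFin lee_fin (le_trans (Im_le_cabs _))// (le_trans (hb p)) ?ler_norm.
Qed.

Lemma cint_translation h (z : R[i]) : cmeas h ->
  cint (fun p => h (pt_inv (pt p + z))) = cint h.
Proof.
move=> [h1 h2]; have tz := area_preserving_translation z.
apply: complex_ext; rewrite /cint/= /Rintegral.
  by rewrite (area_preserving_integral (f := fun p => (complex.Re (h p))%:E) tz)//; exact/measurable_EFinP.
by rewrite (area_preserving_integral (f := fun p => (complex.Im (h p))%:E) tz)//; exact/measurable_EFinP.
Qed.

End ComplexIntegral.

(** * The Gaussian weight *)

Section Gaussian.
Context {R : realType}.
Implicit Types (z w : R[i]).

Lemma omega_gt0 z : 0 < omega z.
Proof. by rewrite mulr_gt0 ?expR_gt0// invr_gt0 pi_gt0. Qed.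

Lemma omega_ge0 z : 0 <= omega z.
Proof. exact: ltW (omega_gt0 z). Qed.

Lemma omegaE z : (omega z)%:C = (pi^-1)%:C * cexp (- (z * z^*)).
Proof.
have -> : - (z * z^*) = (- cabs z ^+ 2)%:C by rewrite mulrJ rmorphN.
by rewrite cexp_real -rmorphM.
Qed.

Lemma integral_omega : (\int[area]_p (omega (pt p))%:E = 1 :> \bar R)%E.
Proof.
have gE (p : plane R) : (omega (pt p))%:E = ((pi^-1 * gauss_fun p.1)%:E * (gauss_fun p.2)%:E :> \bar R)%E.
  rewrite -EFinM /omega /gauss_fun cabs_sqr/= opprD expRD; congr (_%:E); ring.
rewrite /area fubini_tonelli1//; last 2 first.
- by apply/measurable_EFinP; exact: measurable_omega.
- by move=> p; rewrite lee_fin omega_ge0.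
rewrite /fubini_F; under eq_integral => x _.
  under eq_integral do rewrite gE/=.
  rewrite ge0_integralZl//; last 3 first.
  - by apply/measurable_EFinP; exact: measurable_gauss_fun.
  - by move=> y _; rewrite lee_fin gauss_fun_ge0.
  - by rewrite lee_fin mulr_ge0 ?gauss_fun_ge0// invr_ge0 pi_ge0.
  rewrite integralT_gauss muleC EFinM muleA.
  over.
rewrite ge0_integralZl//; last 3 first.
- by apply/measurable_EFinP; exact: measurable_gauss_fun.
- by move=> y _; rewrite lee_fin gauss_fun_ge0.
- by rewrite lee_fin mulr_ge0 ?sqrtr_ge0// invr_ge0 pi_ge0.
rewrite integralT_gauss -!EFinM mulrAC -expr2 sqr_sqrtr ?pi_ge0//.
by rewrite mulfV// gt_eqF// pi_gt0.
Qed.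

(** Completing the square: the integrand is [e^(|z|^2)] times the Gaussian
    centred at [z]. *)
Lemma integral_exp_omega z :
  (\int[area]_p (expR (2 * complex.Re (pt p * z^*)) * omega (pt p))%:E = (expR (cabs z ^+ 2))%:E)%E.
Proof.
have m1 : measurable_fun setT (fun p : plane R => expR (cabs z ^+ 2) * omega (pt p)).
  by apply: measurable_funM; [exact: measurable_cst|exact: measurable_omega].
have m2 : measurable_fun setT (fun p : plane R => expR (cabs z ^+ 2) * omega (pt p - z)).
  have [mS _] := area_preserving_translation (- z).
  rewrite (_ : (fun p => _) = (fun p : plane R => expR (cabs z ^+ 2) * omega (pt p)) \o (fun p => pt_inv (pt p - z))).
    exact: measurableT_comp.
  by apply/funext => p /=; rewrite ptK.
transitivity (\int[area]_p (expR (cabs z ^+ 2) * omega (pt p - z))%:E)%E.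
  apply: eq_integral => p _; congr (_%:E); rewrite /omega mulrCA [RHS]mulrCA; congr (_ * _).
  rewrite -!expRD; congr expR; rewrite !cabs_sqr !ReD !ImD !ReN !ImN ReM ReJ ImJ; ring.
transitivity (\int[area]_p (expR (cabs z ^+ 2) * omega (pt p))%:E)%E.
  rewrite -[RHS](area_preserving_integral (area_preserving_translation (- z))); last exact/measurable_EFinP.
  by apply: eq_integral => p _; rewrite ptK.
under eq_integral do rewrite EFinM.
rewrite ge0_integralZl//.
- by rewrite integral_omega mule1.
- by apply/measurable_EFinP; exact: measurable_omega.
- by move=> p _; rewrite lee_fin omega_ge0.
Qed.

(** It controls the norms of entire functions of exponential type, see
    [fock_growth]. *)
Definition exp_mass (a : R) : \bar R :=
  (\int[area]_p (expR (a * cabs (pt p)) * omega (pt p))%:E)%E.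

Lemma expR_norm_le (a x : R) : 0 <= a -> expR (a * `|x|) <= expR (a * x) + expR (- (a * x)).
Proof.
move=> a0; have [x0|x0] := leP 0 x.
  by rewrite ger0_norm// lerDl expR_ge0.
by rewrite ltr0_norm// mulrN lerDr expR_ge0.
Qed.

Lemma measurable_exp_omega (a : R) :
  measurable_fun setT (fun p : plane R => expR (a * cabs (pt p)) * omega (pt p)).
Proof.
apply: measurable_funM; last exact: measurable_omega.
apply: measurableT_comp; first exact: measurable_expR.
apply: measurable_funM; first exact: measurable_cst.
by apply: measurable_cabs; apply: (@entire_cmeas R (fun z => z)); exact: entire_id.
Qed.

(** [e^(a|u|)] is dominated by the sum of the four exponentials
    [e^(2 Re(u conj z))] with [z] at the corners of a square. *)
Lemma exp_mass_fin (a : R) : 0 <= a -> (exp_mass a < +oo)%E.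
Proof.
move=> a0.
pose k z (p : plane R) := expR (2 * complex.Re (pt p * z^*)) * omega (pt p).
pose b := a / 2.
have mk z : measurable_fun setT (k z).
  apply: measurable_funM; last exact: measurable_omega.
  apply: measurableT_comp; first exact: measurable_expR.
  apply: measurable_funM; first exact: measurable_cst.
  by have [] := entire_cmeas (entireM (@entire_id R) (@entire_cst R z^*)).
have k0 z p : 0 <= k z p by rewrite mulr_ge0 ?expR_ge0 ?omega_ge0.
have kfin z : (\int[area]_p (k z p)%:E < +oo)%E by rewrite integral_exp_omega ltry.
apply: (@le_lt_trans _ _ (\int[area]_p ((k (b +i* b) p)%:E + (k (b -i* b) p)%:E + (k (- b +i* b) p)%:E + (k (- b -i* b) p)%:E))%E).
  apply: ge0_le_integral => //.
  - by move=> p _; rewrite lee_fin mulr_ge0 ?expR_ge0 ?omega_ge0.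
  - by apply/measurable_EFinP; exact: measurable_exp_omega.
  - by under eq_fun do rewrite -!EFinD; apply/measurable_EFinP; do 3 (apply: measurable_funD => //).
  move=> p _; rewrite -!EFinD lee_fin /k -!mulrDl ler_wpM2r ?omega_ge0//.
  apply: (@le_trans _ _ (expR (a * `|p.1 : R|) * expR (a * `|p.2 : R|))).
    by rewrite -expRD -mulrDr ler_expR ler_wpM2l// cabs_le_ReIm.
  apply: (le_trans (ler_pM (expR_ge0 _) (expR_ge0 _) (expR_norm_le _ a0) (expR_norm_le _ a0))).
  have E (c d : R) : expR (2 * complex.Re (pt p * (c +i* d)^*)) = expR (2 * c * (p.1 : R)) * expR (2 * d * (p.2 : R)).
    by rewrite ReM/= -expRD; congr expR; ring.
  have bE : 2 * b = a by rewrite /b; field.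
  by rewrite !E !mulrN bE !mulNr le_eqVlt; apply/orP; left; apply/eqP; ring.
rewrite ge0_integralD//; last 4 first.
- by move=> p _; rewrite -!EFinD lee_fin !addr_ge0.
- by under eq_fun do rewrite -!EFinD; apply/measurable_EFinP; do 2 (apply: measurable_funD => //).
- by move=> p _; rewrite lee_fin.
- exact/measurable_EFinP.
rewrite ge0_integralD//; last 4 first.
- by move=> p _; rewrite -!EFinD lee_fin !addr_ge0.
- by under eq_fun do rewrite -!EFinD; apply/measurable_EFinP; apply: measurable_funD.
- by move=> p _; rewrite lee_fin.
- exact/measurable_EFinP.
rewrite ge0_integralD//; last 4 first.
- by move=> p _; rewrite lee_fin.
- exact/measurable_EFinP.
- by move=> p _; rewrite lee_fin.
- exact/measurable_EFinP.
by do 3 (apply: lte_add_pinfty => //).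
Qed.

End Gaussian.

(** * The Hermitian form of the Fock space *)

Section FockSpace.
Context {R : realType}.
Implicit Types (f g : R[i] -> R[i]) (z w c : R[i]).

Definition sqn f : R := fine (fock_sqnorm f).

Lemma sqn_ge0 f : 0 <= sqn f.
Proof.
by rewrite fine_ge0// integral_ge0// => p _; rewrite lee_fin mulr_ge0 ?sqr_ge0 ?omega_ge0.
Qed.

Lemma fock_norm_sqr f : fock_norm f ^+ 2 = sqn f.
Proof. by rewrite sqr_sqrtr// sqn_ge0. Qed.

Lemma fock_norm_ge0 f : 0 <= fock_norm f.
Proof. exact: sqrtr_ge0. Qed.

Lemma fock_sqnorm_ge0 f : (0 <= fock_sqnorm f)%E.
Proof. by apply: integral_ge0 => p _; rewrite lee_fin mulr_ge0 ?sqr_ge0 ?omega_ge0. Qed.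

Lemma sqnE f : fock f -> fock_sqnorm f = (sqn f)%:E.
Proof. by move=> [_ ff]; rewrite /sqn fineK// ge0_fin_numE// fock_sqnorm_ge0. Qed.

Lemma measurable_sqweight f : entire f ->
  measurable_fun setT (fun p : plane R => cabs (f (pt p)) ^+ 2 * omega (pt p)).
Proof.
move=> ef; apply: measurable_funM; last exact: measurable_omega.
by apply: measurable_funX; apply: measurable_cabs; exact: entire_cmeas.
Qed.

Lemma fock_entire f : fock f -> entire f. Proof. by case. Qed.

Lemma fock_sqintegrable f : fock f ->
  area.-integrable setT (fun p => (cabs (f (pt p)) ^+ 2 * omega (pt p))%:E).
Proof.
move=> [ef ff]; apply/integrableP; split.
  by apply/measurable_EFinP; exact: measurable_sqweight.
rewrite (_ : integral _ _ _ = fock_sqnorm f)//; apply: eq_integral => p _.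
by rewrite gee0_abs// lee_fin mulr_ge0 ?sqr_ge0 ?omega_ge0.
Qed.

Definition weighted f g (p : plane R) := f (pt p) * (g (pt p))^* * (omega (pt p))%:C.

Lemma fock_innerE f g : fock_inner f g = cint (weighted f g).
Proof. by []. Qed.

Lemma cmeas_weighted f g : entire f -> entire g -> cmeas (weighted f g).
Proof.
move=> ef eg; apply: cmeasM; last by apply: cmeas_real; exact: measurable_omega.
by apply: cmeasM; [exact: entire_cmeas|apply: cmeasJ; exact: entire_cmeas].
Qed.

Lemma cabs_omega z : cabs (omega z)%:C = omega z.
Proof. by rewrite ger0_cabs// omega_ge0. Qed.

Lemma weighted_integrable f g : fock f -> fock g -> cintegrable (weighted f g).
Proof.
move=> ff fg.
apply: (@cintegrable_le _ _ (fun p => cabs (f (pt p)) ^+ 2 * omega (pt p) + cabs (g (pt p)) ^+ 2 * omega (pt p))).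
- by apply: cmeas_weighted; apply: fock_entire.
- by under eq_fun do rewrite EFinD; apply: integrableD => //; exact: fock_sqintegrable.
move=> p; rewrite !cabsM cabsJ cabs_omega -mulrDl ler_wpM2r ?omega_ge0//.
have := sqr_ge0 (cabs (f (pt p)) - cabs (g (pt p))).
have := mulr_ge0 (cabs_ge0 (f (pt p))) (cabs_ge0 (g (pt p))).
nra.
Qed.

Lemma fock_comb a f g : fock f -> fock g -> fock (fun z => a * f z + g z).
Proof.
move=> ff fg; split.
  apply: entireD; last exact: fock_entire.
  by apply: entireM; [exact: entire_cst|exact: fock_entire].
apply: (@le_lt_trans _ _ (\int[area]_p ((2 * cabs a ^+ 2)%:E * (cabs (f (pt p)) ^+ 2 * omega (pt p))%:E + 2%:E * (cabs (g (pt p)) ^+ 2 * omega (pt p))%:E))%E).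
  apply: ge0_le_integral => //.
  - by move=> p _; rewrite lee_fin mulr_ge0 ?sqr_ge0 ?omega_ge0.
  - apply/measurable_EFinP; apply: (@measurable_sqweight (fun z => a * f z + g z)).
    apply: entireD; last exact: fock_entire.
    by apply: entireM; [exact: entire_cst|exact: fock_entire].
  - under eq_fun do rewrite -!EFinM -EFinD.
    apply/measurable_EFinP; apply: measurable_funD; apply: measurable_funM => //;
      by apply: measurable_sqweight; apply: fock_entire.
  move=> p _; rewrite -!EFinM -EFinD lee_fin; move: (omega_ge0 (pt p)).
  move: (omega _) => o o0; rewrite !mulrA -mulrDl ler_wpM2r//.
  apply: (@le_trans _ _ ((cabs a * cabs (f (pt p)) + cabs (g (pt p))) ^+ 2)).
    by rewrite ler_sqr ?nnegrE ?addr_ge0 ?mulr_ge0 ?cabs_ge0// -cabsM cabsD.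
  have := sqr_ge0 (cabs a * cabs (f (pt p)) - cabs (g (pt p))); nra.
rewrite integralD//.
- rewrite !integralZl//; [|exact: fock_sqintegrable..].
  by rewrite -/(fock_sqnorm f) -/(fock_sqnorm g) !sqnE// -!EFinM -EFinD ltry.
- by apply: integrableZl => //; exact: fock_sqintegrable.
- by apply: integrableZl => //; exact: fock_sqintegrable.
Qed.

Lemma fock_innerDl a f g k : fock f -> fock g -> fock k ->
  fock_inner (fun z => a * f z + g z) k = a * fock_inner f k + fock_inner g k.
Proof.
move=> ff fg fk; rewrite !fock_innerE.
have [_ <-] := cint_lin a (weighted_integrable ff fk) (weighted_integrable fg fk).
by congr cint; apply/funext => p; rewrite /weighted; ring.
Qed.

Lemma fock_innerC f g : fock f -> fock g -> fock_inner g f = (fock_inner f g)^*.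
Proof.
move=> ff fg; rewrite !fock_innerE -cintJ; last exact: weighted_integrable.
congr cint; apply/funext => p; rewrite /weighted !conjM conjK conjR.
by rewrite (mulrC (g _)).
Qed.

Lemma fock_innerDr a f g k : fock f -> fock g -> fock k ->
  fock_inner k (fun z => a * f z + g z) = a^* * fock_inner k f + fock_inner k g.
Proof.
move=> ff fg fk; rewrite fock_innerC//; last exact: fock_comb.
by rewrite fock_innerDl// conjD conjM -!fock_innerC.
Qed.

Lemma fock_inner_self f : fock f -> fock_inner f f = (sqn f)%:C.
Proof.
move=> ff; have E p : weighted f f p = (cabs (f (pt p)) ^+ 2 * omega (pt p))%:C.
  by rewrite /weighted mulrJ -[RHS]/((real_complex R) _) [RHS]rmorphM.
apply: complex_ext => /=; first by apply: eq_Rintegral => p _; rewrite -/(weighted f f p) E.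
transitivity (Rintegral (@area R) setT (fun=> 0)); last by rewrite /Rintegral integral0.
by apply: eq_Rintegral => p _; rewrite -/(weighted f f p) E.
Qed.

Lemma fock_cst0 : fock (fun=> 0 : R[i]).
Proof.
split; first exact: entire_cst.
rewrite /fock_sqnorm; under eq_integral do rewrite cabs0 expr0n/= mul0r.
by rewrite integral0.
Qed.

Lemma fock_scale a f : fock f -> fock (fun z => a * f z).
Proof.
move=> ff; have := fock_comb a ff fock_cst0.
by under eq_fun do rewrite addr0.
Qed.

Lemma fockB f g : fock f -> fock g -> fock (fun z => f z - g z).
Proof.
move=> ff fg; have := fock_comb (-1) fg ff.
by under eq_fun do rewrite mulN1r addrC.
Qed.

Lemma fock_inner0l k : fock k -> @fock_inner R (fun=> 0) k = 0.
Proof.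
move=> fk; have := fock_innerDl (-1) fock_cst0 fock_cst0 fk.
by under eq_fun do rewrite mulr0 addr0; rewrite mulN1r addNr.
Qed.

Lemma fock_innerZl a f k : fock f -> fock k ->
  fock_inner (fun z => a * f z) k = a * fock_inner f k.
Proof.
move=> ff fk; have := fock_innerDl a ff fock_cst0 fk.
by under eq_fun do rewrite addr0; rewrite fock_inner0l// addr0.
Qed.

Lemma fock_innerBl f g k : fock f -> fock g -> fock k ->
  fock_inner (fun z => f z - g z) k = fock_inner f k - fock_inner g k.
Proof.
move=> ff fg fk; have := fock_innerDl (-1) fg ff fk.
by under eq_fun do rewrite mulN1r addrC; rewrite mulN1r addrC.
Qed.

Lemma fock_innerBr f g k : fock f -> fock g -> fock k ->
  fock_inner k (fun z => f z - g z) = fock_inner k f - fock_inner k g.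
Proof.
move=> ff fg fk; rewrite fock_innerC ?fock_innerBl ?conjB -?fock_innerC//; exact: fockB.
Qed.

Lemma sqnB f g c : fock f -> fock g ->
  sqn (fun z => - c * g z + f z) =
    sqn f - 2 * complex.Re (c^* * fock_inner f g) + cabs c ^+ 2 * sqn g.
Proof.
move=> ff fg; apply: (@complexI R).
have fh := fock_comb (- c) fg ff.
rewrite -fock_inner_self// fock_innerDl// !fock_innerDr// !fock_inner_self//.
rewrite (fock_innerC ff fg) conjN cabs_sqr.
set I := fock_inner f g.
apply: complex_ext; rewrite !(ReD, ImD, ReN, ImN, ReM, ImM, ReJ, ImJ)/=; ring.
Qed.

(** The squared norm of [f - t <f, g> g] is a nonnegative polynomial in the real
    variable [t]. *)
Lemma fock_cauchy_schwarz f g : fock f -> fock g ->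
  cabs (fock_inner f g) <= fock_norm f * fock_norm g.
Proof.
move=> ff fg; rewrite -ler_sqr ?nnegrE ?mulr_ge0 ?fock_norm_ge0 ?cabs_ge0//.
rewrite exprMn !fock_norm_sqr; set c := fock_inner f g.
(* squared norm of f - t c g *)
have key (t : R) : 0 <= sqn f - 2 * t * cabs c ^+ 2 + t ^+ 2 * cabs c ^+ 2 * sqn g.
  have := sqn_ge0 (fun z => - (t%:C * c) * g z + f z).
  rewrite sqnB// -/c cabsM cabs_real exprMn real_normK ?num_real// conjM conjR.
  have -> : complex.Re (t%:C * c^* * c) = t * cabs c ^+ 2.
    by rewrite -mulrA (mulrC c^*) mulrJ ReM/= mul0r subr0.
  by rewrite !mulrA.
have [g0|g0] := eqVneq (sqn g) 0.
  rewrite g0 mulr0; rewrite leNgt; apply/negP => c0.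
  (* without its quadratic term the polynomial is affine, and takes the value -1 *)
  have := key ((sqn f + 1) / (2 * cabs c ^+ 2)); rewrite g0 mulr0 addr0.
  have -> : 2 * ((sqn f + 1) / (2 * cabs c ^+ 2)) * cabs c ^+ 2 = sqn f + 1.
    by field; rewrite -sqrf_eq0 gt_eqF.
  by lra.
have gp : 0 < sqn g by rewrite lt_def g0 sqn_ge0.
have := key (sqn g)^-1.
have -> : sqn f - 2 * (sqn g)^-1 * cabs c ^+ 2 + (sqn g)^-1 ^+ 2 * cabs c ^+ 2 * sqn g =
  sqn f - cabs c ^+ 2 / sqn g by field.
by rewrite subr_ge0 ler_pdivrMr.
Qed.

(** The monomials, their products with reproducing kernels and the remainders
    of these in the parameter [z] are all controlled by this criterion. *)
Lemma fock_growth f (C a : R) : entire f -> 0 <= C -> 0 <= a ->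
  (forall z, cabs (f z) <= C * expR (a * cabs z)) ->
  fock f /\ sqn f <= C ^+ 2 * fine (exp_mass (2 * a)).
Proof.
move=> ef C0 a0 fb.
have a20 : 0 <= 2 * a by rewrite mulr_ge0.
have le : (fock_sqnorm f <= (C ^+ 2)%:E * exp_mass (2 * a))%E.
  rewrite /exp_mass -ge0_integralZl//; last 3 first.
  - by apply/measurable_EFinP; exact: measurable_exp_omega.
  - by move=> p _; rewrite lee_fin mulr_ge0 ?expR_ge0 ?omega_ge0.
  - by rewrite lee_fin sqr_ge0.
  apply: ge0_le_integral => //.
  - by move=> p _; rewrite lee_fin mulr_ge0 ?sqr_ge0 ?omega_ge0.
  - by apply/measurable_EFinP; exact: measurable_sqweight.
  - under eq_fun do rewrite -EFinM.
    by apply/measurable_EFinP; apply: measurable_funM => //; exact: measurable_exp_omega.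
  move=> p _; rewrite -EFinM lee_fin; move: (omega_ge0 (pt p)).
  move: (omega _) => o o0; rewrite mulrA ler_wpM2r//.
  have -> : C ^+ 2 * expR (2 * a * cabs (pt p)) = (C * expR (a * cabs (pt p))) ^+ 2.
    by rewrite exprMn -expRM_natl; congr (_ * expR _); ring.
  by rewrite ler_sqr ?nnegrE ?cabs_ge0 ?mulr_ge0 ?expR_ge0.
have mE : exp_mass (2 * a) = (fine (exp_mass (2 * a)))%:E.
  rewrite fineK// ge0_fin_numE ?exp_mass_fin//.
  by apply: integral_ge0 => p _; rewrite lee_fin mulr_ge0 ?expR_ge0 ?omega_ge0.
rewrite mE -EFinM in le.
have ff : fock f by split => //; apply: le_lt_trans le (ltry _).
by split=> //; move: le; rewrite sqnE// lee_fin.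
Qed.

Lemma fock_cst1 : fock (fun=> 1 : R[i]).
Proof.
have [] := @fock_growth (fun=> 1) 1 0 (@entire_cst R 1) ler01 (lexx 0) _ => //.
by move=> z; rewrite cabs1 mul0r expR0 mul1r.
Qed.

End FockSpace.

(** * Mean value property and reproducing kernel *)

Section MeanValue.
Context {R : realType}.
Local Notation lam := (@lebesgue_measure R).
Implicit Types (f g : R[i] -> R[i]) (z w u : R[i]).

Lemma continuous_circle_Re f u : entire f ->
  continuous (fun t : R => complex.Re (f (cexp (0 +i* t) * u))).
Proof.
move=> ef; have eH : entire (fun z => f (cexp z * u)).
  by apply: (entire_comp ef); apply: entireM; [exact: entire_cexp|exact: entire_cst].
by have [_ _ _ /(_ 0)] := closed_form_cont (entire_polar_closed_form eH).
Qed.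

Definition re_weight f (p : plane R) : R := complex.Re (f (pt p)) * omega (pt p).

Lemma measurable_phi f : entire f -> measurable_fun setT (re_weight f).
Proof.
move=> ef; apply: measurable_funM; last exact: measurable_omega.
by have [] := entire_cmeas ef.
Qed.

Lemma Re_weighted1 f p : complex.Re (weighted f (fun=> 1) p) = re_weight f p.
Proof. by rewrite /weighted rmorph1 mulr1 ReM/= mulr0 subr0. Qed.

Lemma integrable_phi f : fock f -> area.-integrable setT (fun p => (re_weight f p)%:E).
Proof.
move=> ff; have [+ _] := weighted_integrable ff (@fock_cst1 R).
by under eq_fun do rewrite Re_weighted1.
Qed.

Definition rotation (t : R) (p : plane R) : plane R := pt_inv (cexp (0 +i* t) * pt p).

Lemma cabs_cexp_i (t : R) : cabs (cexp (0 +i* t)) = 1.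
Proof. by rewrite cabs_cexp/= expR0. Qed.

Lemma phi_rot f t p :
  complex.Re (f (cexp (0 +i* t) * pt p)) * omega (pt p) = re_weight f (rotation t p).
Proof. by rewrite /re_weight ptK /omega cabsM cabs_cexp_i mul1r. Qed.

Definition turn : set R := `[0, pi *+ 2].

Lemma turnE : lam turn = (pi *+ 2)%:E.
Proof.
rewrite lebesgue_measure_itv/= lte_fin oppr0 adde0.
by rewrite (_ : 0 < pi *+ 2)// mulrn_wgt0// pi_gt0.
Qed.

(** The factor [turn] restricts the angle to one full turn, so that Fubini's
    theorem can be applied on the whole product space. *)
Definition rotated_weight f (q : measurableTypeR R * plane R) : R :=
  \1_turn (q.1 : R) * (complex.Re (f (cexp (0 +i* q.1) * pt q.2)) * omega (pt q.2)).

Lemma rotated_weightE f t p : rotated_weight f (t, p) = \1_turn t * re_weight f (rotation t p).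
Proof. by rewrite /rotated_weight phi_rot. Qed.

Lemma measurable_turn : measurable_fun setT (fun t : measurableTypeR R => \1_turn (t : R) : R).
Proof. by apply: measurable_indic; exact: measurable_itv. Qed.

Lemma measurable_K f : entire f -> measurable_fun setT (rotated_weight f).
Proof.
move=> ef.
have mr : measurable_fun setT (fun q : measurableTypeR R * plane R => rotation q.1 q.2).
  have m1 : measurable_fun setT (fun q : measurableTypeR R * plane R => (q.2.1 : R)).
    by apply: (measurableT_comp (f := fst)) => //; exact: measurable_snd.
  have m2 : measurable_fun setT (fun q : measurableTypeR R * plane R => (q.2.2 : R)).
    by apply: (measurableT_comp (f := snd)) => //; exact: measurable_snd.
  have mc : measurable_fun setT (fun q : measurableTypeR R * plane R => cos (q.1 : R)).
    apply: (measurableT_comp (f := @cos R)); last exact: measurable_fst.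
    by apply: continuous_measurable_fun; exact: continuous_cos.
  have ms : measurable_fun setT (fun q : measurableTypeR R * plane R => sin (q.1 : R)).
    apply: (measurableT_comp (f := @sin R)); last exact: measurable_fst.
    by apply: continuous_measurable_fun; exact: continuous_sin.
  apply/measurable_fun_pairP; split.
    rewrite (_ : _ \o _ = fun q : measurableTypeR R * plane R => cos (q.1 : R) * q.2.1 - sin (q.1 : R) * q.2.2).
      by apply: measurable_funB; apply: measurable_funM.
    by apply/funext => q; rewrite /rotation/= expR0 !mul1r.
  rewrite (_ : _ \o _ = fun q : measurableTypeR R * plane R => cos (q.1 : R) * q.2.2 + sin (q.1 : R) * q.2.1).
    by apply: measurable_funD; apply: measurable_funM.
  by apply/funext => q; rewrite /rotation/= expR0 !mul1r.
rewrite /rotated_weight; apply: measurable_funM.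
  by apply: (measurableT_comp measurable_turn); exact: measurable_fst.
under eq_fun do rewrite phi_rot.
exact: (measurableT_comp (measurable_phi ef) mr).
Qed.

(** Rotations preserve both the area and the weight. *)
Lemma rot_integral t (G : plane R -> \bar R) : measurable_fun setT G ->
  (\int[area]_p ((\1_turn t)%:E * G (rotation t p)) = (\1_turn t)%:E * \int[area]_p G p)%E.
Proof.
move=> mG; rewrite indicE; case: (t \in turn) => /=; last first.
  by under eq_integral do rewrite mul0e; rewrite integral0 mul0e.
under eq_integral do rewrite mul1e.
by rewrite mul1e (area_preserving_integral (area_preserving_rotation (cabs_cexp_i t))).
Qed.

Lemma integral_turn (a : R) : (\int[lam]_t ((\1_turn t)%:E * a%:E) = (a * (pi *+ 2))%:E)%E.
Proof.
have mt : measurable (turn : set (measurableTypeR R)) by exact: measurable_itv.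
under eq_integral do rewrite muleC.
rewrite integralZl//; last first.
  apply/integrableP; split.
    by apply/measurable_EFinP; exact: measurable_turn.
  under eq_integral => t _ do rewrite gee0_abs ?lee_fin//.
  have -> : (\int[lam]_t (\1_turn t)%:E = lam turn)%E by rewrite integral_indic// setIT.
  by rewrite turnE ltry.
have -> : (\int[lam]_t (\1_turn t)%:E = lam turn)%E by rewrite integral_indic// setIT.
by rewrite turnE EFinM.
Qed.

Lemma circle_integral f u : entire f ->
  let g (t : measurableTypeR R) := (\1_turn (t : R) * complex.Re (f (cexp (0 +i* t) * u)))%:E in
  lam.-integrable setT g /\ (\int[lam]_t g t = (complex.Re (f 0) * (pi *+ 2))%:E)%E.
Proof.
move=> ef g; pose h (t : measurableTypeR R) := (complex.Re (f (cexp (0 +i* (t : R)) * u)))%:E.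
have gE : g = h \_ turn.
  by apply/funext => t; rewrite /g patchE indicE; case: (_ \in _); rewrite ?mul1r ?mul0r.
have mt : measurable (turn : set (measurableTypeR R)) by exact: measurable_itv.
have hi : lam.-integrable turn h by exact: continuous_integrable_segment (@continuous_circle_Re f u ef).
split; first by rewrite gE; apply/(integrable_mkcond h mt).
rewrite gE -integral_mkcond mulrC -(circle_mean_Re u ef) /segint /Rintegral fineK//.
exact: (integrable_fin_num mt hi).
Qed.

(** Squares centred at the origin exhaust the plane. *)
Lemma area_sigma_finite : sigma_finite setT (lam \x lam)%E.
Proof.
pose I n : set (measurableTypeR R) := `[- n%:R, n%:R]%classic.
have mI n : measurable (I n) by exact: measurable_itv.
have Ifin n : (lam (I n) < +oo)%E.
  by rewrite lebesgue_measure_itv/=; case: ifP => _; rewrite -?EFinB ltry.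
exists (fun n => I n `*` I n).
  apply/esym/seteqP; split => // -[x y] _.
  exists (Num.bound (Num.max `|x : R| `|y : R|)) => //.
  have : Num.max `|x : R| `|y : R| < (Num.bound (Num.max `|x : R| `|y : R|))%:R.
    by apply: archi_boundP; rewrite le_max normr_ge0.
  move: (Num.bound _) => n; rewrite gt_max !ltr_norml => /andP[/andP[x1 x2] /andP[y1 y2]].
  by split; rewrite /I/= in_itv/= !ltW.
move=> n; split; first exact: measurableX.
have Inum : lam (I n) \is a fin_num by rewrite ge0_fin_numE.
rewrite product_measure1E//; apply: lte_mul_pinfty => //; exact: Ifin.
Qed.

(** The double integral over angles and points equals [2 pi Re <f, 1>] when the
    points are integrated first, by rotation invariance, and [2 pi Re f(0)] when
    the angles are integrated first, by the circle mean. *)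
Lemma fock_mean_Re f : fock f -> complex.Re (fock_inner f (fun=> 1)) = complex.Re (f 0).
Proof.
move=> ff; have ef := fock_entire ff.
have -> : complex.Re (fock_inner f (fun=> 1)) = \int[area]_p re_weight f p.
  by apply: eq_Rintegral => p _; exact: Re_weighted1.
set A := \int[area]_p re_weight f p.
have AE : (\int[area]_p (re_weight f p)%:E)%E = A%:E.
  by rewrite fineK//; apply: integrable_fin_num => //; exact: integrable_phi.
have mK : measurable_fun setT (fun q => (rotated_weight f q)%:E).
  by apply/measurable_EFinP; exact: measurable_K.
have Gint : (\int[area]_p ((complex.Re (f 0) * (pi *+ 2))%:E * (omega (pt p))%:E) =
    (complex.Re (f 0) * (pi *+ 2))%:E)%E.
  rewrite integralZl//; first by rewrite integral_omega mule1.
  apply/integrableP; split; first by apply/measurable_EFinP; exact: measurable_omega.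
  apply: (@le_lt_trans _ _ 1%E); last exact: ltry.
  rewrite -(@integral_omega R) le_eqVlt; apply/orP; left; apply/eqP.
  by apply: eq_integral => p _; rewrite gee0_abs ?lee_fin ?omega_ge0.
have Kfin : (\int[lam]_x \int[(lam \x lam)]_y `|(rotated_weight f (x, y))%:E| < +oo)%E.
  have /integrableP[_ Bfin] := integrable_phi ff.
  have B0 : (0 <= \int[area]_p `|(re_weight f p)%:E|)%E by apply: integral_ge0.
  rewrite (_ : (fun x => _) = (fun t => (\1_turn t)%:E * (fine (\int[area]_p `|(re_weight f p)%:E|))%:E)%E).
    by rewrite integral_turn ltry.
  apply/funext => t; rewrite fineK ?ge0_fin_numE//.
  rewrite -rot_integral; last by apply: measurableT_comp => //; apply/measurable_EFinP; exact: measurable_phi.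
  apply: eq_integral => p _; by rewrite rotated_weightE EFinM abseM gee0_abs// lee_fin indicE.
pose sf := Measure_isSigmaFinite.Build _ _ _ (lam \x lam)%E area_sigma_finite.
pose area' : {sigma_finite_measure set (plane R) -> \bar R} := HB.pack (lam \x lam)%E sf.
have := Fubini (proj2 (@integrable12ltyP _ _ _ _ R lam area' _ mK) Kfin).
rewrite (_ : (fun x => _) = (fun t => (\1_turn t)%:E * A%:E)%E); last first.
  apply/funext => t; rewrite -AE -rot_integral; last by apply/measurable_EFinP; exact: measurable_phi.
  by apply: eq_integral => p _; rewrite rotated_weightE EFinM.
rewrite integral_turn.
rewrite (_ : (fun y => _) = (fun p => (complex.Re (f 0) * (pi *+ 2))%:E * (omega (pt p))%:E)%E); last first.
  apply/funext => p.
  have [gi gE] := circle_integral (pt p) ef.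
  rewrite -gE muleC -(integralZl measurableT gi).
  by apply: eq_integral => t _; rewrite /rotated_weight/= -EFinM; congr (_%:E); ring.
move=> h; move: (etrans h Gint) => -[] /mulIf; apply.
by rewrite gt_eqF// mulrn_wgt0// pi_gt0.
Qed.

(** The imaginary part of [f] is the real part of [- i f]. *)
Lemma fock_mean f : fock f -> fock_inner f (fun=> 1) = f 0.
Proof.
move=> ff; apply: complex_ext; first exact: fock_mean_Re.
have ImE z : complex.Im z = complex.Re (- 'i%C * z) by rewrite ReM/= oppr0 mul0r sub0r mulN1r opprK.
rewrite !ImE -fock_innerZl//; last exact: fock_cst1.
by rewrite fock_mean_Re//; exact: fock_scale.
Qed.

Lemma entire_kernel z : entire (fock_kernel z).
Proof.
apply: (entire_comp (f := @cexp R)); first exact: entire_cexp.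
exact: (entireM (@entire_id R) (@entire_cst R z^*)).
Qed.

(** Completing the square in the exponent moves the Gaussian from [w + z] to
    [w]. *)
Lemma weyl_weight z w :
  (cexp ((w + z) * z^*))^* * (omega (w + z))%:C = cexp (- (w * z^*)) * (omega w)%:C.
Proof.
rewrite !omegaE cexpJ !conjD !conjM conjK !(mulrCA _ (_^-1)%:C) -!cexpD.
by congr (_ * cexp _); ring.
Qed.

Lemma fock_kernel_fock z : fock (fock_kernel z).
Proof.
split; first exact: entire_kernel.
rewrite (_ : fock_sqnorm _ = \int[area]_p (expR (2 * complex.Re (pt p * z^*)) * omega (pt p))%:E)%E.
  by rewrite integral_exp_omega ltry.
apply: eq_integral => p _; congr (_ * _)%:E.
by rewrite /fock_kernel cabs_cexp -expRM_natl.
Qed.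

(** Up to a constant this is the Weyl translation, an isometry of the Fock
    space. *)
Lemma fock_weyl f z : fock f -> fock (fun w => f (w + z) * cexp (- (w * z^*))).
Proof.
move=> [ef ff].
have eg : entire (fun w => f (w + z) * cexp (- (w * z^*))).
  apply: entireM.
    by apply: (entire_comp ef); apply: (entireD (@entire_id R) (@entire_cst R z)).
  apply: (entire_comp (@entire_cexp R)).
  have := entireM (@entire_cst R (-1)) (entireM (@entire_id R) (@entire_cst R z^*)).
  by apply: entire_ext => w; rewrite mulN1r.
split=> //.
pose h (p : plane R) := ((expR (cabs z ^+ 2))%:E * (cabs (f (pt p)) ^+ 2 * omega (pt p))%:E)%E.
have mh : measurable_fun setT (fun p : plane R => (cabs (f (pt p)) ^+ 2 * omega (pt p))%:E).
  by apply/measurable_EFinP; exact: measurable_sqweight.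
have -> : fock_sqnorm (fun w => f (w + z) * cexp (- (w * z^*))) = (\int[area]_p h (pt_inv (pt p + z)%R))%E.
  apply: eq_integral => p _; rewrite /h ptK -EFinM; congr (_%:E).
  rewrite cabsM exprMn cabs_cexp [RHS]mulrCA -mulrA; congr (_ * _).
  rewrite -expRM_natl /omega [RHS]mulrCA [LHS]mulrCA; congr (_ * _); rewrite -!expRD; congr expR.
  by rewrite !cabs_sqr !ReD !ImD ReN ReM ReJ ImJ; ring.
rewrite (area_preserving_integral (area_preserving_translation z)); last exact: measurable_funeM.
rewrite /h ge0_integralZl//.
- by rewrite -/(fock_sqnorm f) lte_mul_pinfty// ?lee_fin ?expR_ge0.
- by move=> p _; rewrite lee_fin mulr_ge0 ?sqr_ge0 ?omega_ge0.
Qed.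

(** The mean value property for the Weyl translate of [f] by [z]. *)
Lemma fock_reproducing f z : fock f -> fock_inner f (fock_kernel z) = f z.
Proof.
move=> ff; have fg := fock_weyl z ff.
have := fock_mean fg; rewrite mul0r oppr0 cexp0 mulr1 add0r => <-.
rewrite !fock_innerE -(cint_translation z); last first.
  by apply: cmeas_weighted; [exact: fock_entire|exact: entire_kernel].
congr cint; apply/funext => p; rewrite /weighted ptK rmorph1 mulr1 -!mulrA.
by congr (_ * _); rewrite -weyl_weight.
Qed.

End MeanValue.

(** * Derivatives as inner products *)

Section Derivatives.
Context {R : realType}.
Implicit Types (f g : R[i] -> R[i]) (z w u h : R[i]).

(** The n-th derivative of the reproducing kernel with respect to the conjugate
    of [z]. *)
Definition kernel_mono n z w : R[i] := w ^+ n * cexp (w * z^*).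

Lemma entire_kernel_mono n z : entire (kernel_mono n z).
Proof.
by apply: entireM; [apply: entireX; exact: entire_id|exact: entire_kernel].
Qed.

Lemma cabsX_le w n : cabs w ^+ n <= expR (n%:R * cabs w).
Proof.
rewrite expRM_natl lerXn2r ?nnegrE ?cabs_ge0 ?expR_ge0//.
by have := expR_ge1Dx (cabs w); lra.
Qed.

Lemma kernel_mono_le n z w : cabs (kernel_mono n z w) <= expR ((n%:R + cabs z) * cabs w).
Proof.
rewrite cabsM cabsX mulrDl expRD ler_pM ?exprn_ge0 ?cabs_ge0 ?cabsX_le//.
by rewrite (le_trans (cabs_cexp_le _))// ler_expR cabsM cabsJ mulrC.
Qed.

Lemma fock_kernel_mono n z : fock (kernel_mono n z).
Proof.
have a0 : 0 <= n%:R + cabs z by rewrite addr_ge0 ?cabs_ge0.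
have [] // := fock_growth (@entire_kernel_mono n z) ler01 a0.
by move=> w; rewrite mul1r kernel_mono_le.
Qed.

Definition moment n f z : R[i] := fock_inner f (kernel_mono n z).

Let rem n z h w : R[i] := - h^* * kernel_mono n.+1 z w + (kernel_mono n (z + h) w - kernel_mono n z w).

Let fock_rem n z h : fock (rem n z h).
Proof.
by apply: fock_comb; [exact: fock_kernel_mono|apply: fockB; exact: fock_kernel_mono].
Qed.

(** The exponent 3 leaves room for the two powers of [|w|] and the factor
    [e^(|w||h|)] of the quadratic remainder of the exponential. *)
Let rem_le n z h w : cabs h <= 1 ->
  cabs (rem n z h w) <= 4 * cabs h ^+ 2 * expR ((n%:R + cabs z + 3) * cabs w).
Proof.
move=> h1.
have -> : rem n z h w = kernel_mono n z w * (cexp (w * h^*) - 1 - w * h^*).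
  by rewrite /rem /kernel_mono conjD mulrDr cexpD exprS; ring.
rewrite cabsM.
have -> : 4 * cabs h ^+ 2 * expR ((n%:R + cabs z + 3) * cabs w) =
   expR ((n%:R + cabs z) * cabs w) * (4 * (expR (2%:R * cabs w) * cabs h ^+ 2) * expR (cabs w)).
  rewrite (_ : (n%:R + cabs z + 3) * cabs w = (n%:R + cabs z) * cabs w + 2%:R * cabs w + cabs w); last by ring.
  by rewrite !expRD; ring.
apply: ler_pM; rewrite ?cabs_ge0 ?kernel_mono_le//.
apply: (le_trans (cabs_cexp_sub1D _)); rewrite cabsM cabsJ.
apply: ler_pM; rewrite ?mulr_ge0 ?sqr_ge0 ?expR_ge0 ?cabs_ge0//.
  by rewrite exprMn ler_wpM2l// ler_wpM2r ?sqr_ge0 ?cabsX_le.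
by rewrite ler_expR ler_piMr ?cabs_ge0.
Qed.

(** Differentiation under the integral sign: the remainder of the kernel has norm
    [O(|h|^2)], and Cauchy-Schwarz transfers this to the inner product. *)
Lemma moment_cdiff n f z : fock f -> cdiff (moment n f) z (moment n.+1 f z).
Proof.
move=> ff e e0.
pose a := n%:R + cabs z + 3; have a0 : 0 <= a by rewrite !addr_ge0 ?cabs_ge0.
pose G := fine (exp_mass (R := R) (2 * a)).
pose K := fock_norm f * 4 * Num.sqrt G.
have K0 : 0 <= K by rewrite !mulr_ge0 ?fock_norm_ge0 ?sqrtr_ge0.
exists (Num.min 1 (e / (K + 1))); first by rewrite lt_min ltr01 divr_gt0// ltr_wpDl.
move=> h; rewrite lt_min => /andP[h1 he].
have C0 : 0 <= 4 * cabs h ^+ 2 by rewrite mulr_ge0 ?sqr_ge0.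
have er : entire (rem n z h) by exact: fock_entire.
have [_ remG] := fock_growth er C0 a0 (fun w => @rem_le n z h w (ltW h1)).
have -> : moment n f (z + h) - moment n f z - moment n.+1 f z * h = fock_inner f (rem n z h).
  have k1 := fock_kernel_mono n.+1 z.
  have k2 := fock_kernel_mono n (z + h).
  have k3 := fock_kernel_mono n z.
  rewrite /rem (fock_innerDr _ k1 (fockB k2 k3) ff) (fock_innerBr k2 k3 ff).
  by rewrite conjN conjK /moment; ring.
apply: (le_trans (fock_cauchy_schwarz ff (fock_rem n z h))).
have nr : fock_norm (rem n z h) <= 4 * cabs h ^+ 2 * Num.sqrt G.
  rewrite /fock_norm -/(sqn _) -[X in X * _](ger0_norm C0) -sqrtr_sqr -sqrtrM ?sqr_ge0//.
  exact: ler_wsqrtr.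
apply: (@le_trans _ _ (K * cabs h * cabs h)).
  by apply: (le_trans (ler_wpM2l (fock_norm_ge0 f) nr)); rewrite /K le_eqVlt; apply/orP; left; apply/eqP; ring.
rewrite ler_wpM2r ?cabs_ge0//; rewrite ltr_pdivlMr ?ltr_wpDl// in he.
have := cabs_ge0 h; nra.
Qed.

Lemma moment0 f : fock f -> moment 0 f = f.
Proof.
move=> ff; apply/funext => z; rewrite -[RHS](fock_reproducing z ff).
congr fock_inner; apply/funext => w; by rewrite /kernel_mono expr0 mul1r.
Qed.

Lemma cderivS n f z D : cdiff (cderiv n f) z D -> cderiv n.+1 f z = D.
Proof.
move=> /cdiff_is_derive dD; rewrite /cderiv derive1nS derive1E.
exact: derive_val.
Qed.

Lemma cderiv_moment n f : fock f -> cderiv n f = moment n f.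
Proof.
move=> ff; elim: n => [|n ih]; first by rewrite moment0.
by apply/funext => z; apply: cderivS; rewrite ih; exact: moment_cdiff.
Qed.

Lemma entire_cderiv n f : fock f -> entire (cderiv n f).
Proof.
move=> ff; rewrite cderiv_moment//; apply/entireP => z.
by exists (moment n.+1 f z); exact: moment_cdiff.
Qed.

Definition mono n w : R[i] := w ^+ n.

Lemma kernel_mono0 n : kernel_mono n 0 = mono n.
Proof. by apply/funext => w; rewrite /kernel_mono conjC0 mulr0 cexp0 mulr1. Qed.

Lemma fock_mono n : fock (mono n).
Proof. by rewrite -kernel_mono0; exact: fock_kernel_mono. Qed.

Lemma inner_mono n f : fock f -> fock_inner f (mono n) = cderiv n f 0.
Proof. by move=> ff; rewrite cderiv_moment// /moment kernel_mono0. Qed.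

Lemma cderiv_mono m n : cderiv n (mono m) = (fun w : R[i] => (m ^_ n)%:R * w ^+ (m - n)).
Proof.
elim: n => [|n ih]; first by apply/funext => w; rewrite ffactn0 mul1r subn0.
apply/funext => w; apply: cderivS; rewrite ih.
rewrite ffactnSr natrM subnS.
have /derivable_cdiff : derivable (fun z : R[i]^o => z ^+ (m - n) : R[i]^o) w 1.
  exact: (@entireX R (fun z => z) (m - n)%N (@entire_id R) w).
rewrite (@exp_derive R[i]) => dX.
move=> e e0; pose c := cabs ((m ^_ n)%:R : R[i]).
have c0 : 0 < c + 1 by rewrite ltr_wpDl ?cabs_ge0.
have [d d0 dP] := dX (e / (c + 1)) (divr_gt0 e0 c0).
exists d => // h hd; have := dP h hd => {}dP.
have -> : (m ^_ n)%:R * (w + h) ^+ (m - n) - (m ^_ n)%:R * w ^+ (m - n) - (m ^_ n)%:R * (m - n)%:R * w ^+ (m - n).-1 * h =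
  (m ^_ n)%:R * ((w + h) ^+ (m - n) - w ^+ (m - n) - (m - n)%:R *: w ^+ (m - n).-1 *: 1 * h).
  by rewrite /GRing.scale/= mulr1; ring.
rewrite cabsM -/c; apply: (@le_trans _ _ (c * (e / (c + 1) * cabs h))).
  by rewrite ler_wpM2l ?cabs_ge0.
rewrite mulrA ler_wpM2r ?cabs_ge0// mulrA ler_pdivrMr//.
by rewrite mulrC ler_wpM2l ?(ltW e0)//; lra.
Qed.

(** By [inner_mono] this is the n-th derivative of a monomial at the origin. *)
Lemma mono_orthogonal m n : fock_inner (mono m) (mono n) = if m == n then (n`!)%:R else 0.
Proof.
rewrite inner_mono; last exact: fock_mono.
rewrite cderiv_mono; case: ltngtP => [mn|nm|->].
- by rewrite ffact_small// mul0r.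
- by rewrite expr0n subn_eq0 leqNgt nm mulr0.
- by rewrite subnn expr0 mulr1 ffactnn.
Qed.

End Derivatives.

(** * Convergence of Taylor polynomials in norm *)

Section Taylor.
Context {R : realType}.
Implicit Types (f g : R[i] -> R[i]) (z w u h : R[i]).

Definition coef n f : R[i] := fock_inner f (mono n) / (n`!)%:R.

Definition taylor N f w : R[i] := \sum_(k < N) coef k f * mono k w.

Lemma fock_sum N (c : 'I_N -> R[i]) (F : 'I_N -> R[i] -> R[i]) : (forall k, fock (F k)) ->
  fock (fun w => \sum_(k < N) c k * F k w).
Proof.
elim: N c F => [|N ih] c F fF.
  by under eq_fun do rewrite big_ord0; exact: fock_cst0.
under eq_fun do rewrite big_ord_recr/= addrC.
by apply: fock_comb => //; apply: (ih (fun k => c (widen_ord (leqnSn N) k)) (fun k => F (widen_ord (leqnSn N) k))).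
Qed.

Lemma inner_suml N (c : 'I_N -> R[i]) (F : 'I_N -> R[i] -> R[i]) g : (forall k, fock (F k)) -> fock g ->
  fock_inner (fun w => \sum_(k < N) c k * F k w) g = \sum_(k < N) c k * fock_inner (F k) g.
Proof.
move=> fF fg; elim: N c F fF => [|N ih] c F fF.
  by under eq_fun do rewrite big_ord0; rewrite big_ord0 fock_inner0l.
under eq_fun do rewrite big_ord_recr/= addrC.
pose w' := widen_ord (leqnSn N).
rewrite fock_innerDl//; last exact: (@fock_sum _ (fun k => c (w' k)) (fun k => F (w' k))).
by rewrite (ih (fun k => c (w' k)) (fun k => F (w' k)))// big_ord_recr/= addrC.
Qed.

Lemma inner_sumr N (c : 'I_N -> R[i]) (F : 'I_N -> R[i] -> R[i]) g : (forall k, fock (F k)) -> fock g ->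
  fock_inner g (fun w => \sum_(k < N) c k * F k w) = \sum_(k < N) (c k)^* * fock_inner g (F k).
Proof.
move=> fF fg; rewrite fock_innerC//; last exact: fock_sum.
rewrite inner_suml// rmorph_sum/=; apply: eq_bigr => k _.
by rewrite rmorphM/= -fock_innerC.
Qed.

Lemma fock_taylor N f : fock (taylor N f).
Proof. by apply: fock_sum => k; exact: fock_mono. Qed.

Lemma fact_neq0 n : (n`!)%:R != 0 :> R[i].
Proof. by rewrite pnatr_eq0 -lt0n fact_gt0. Qed.

Lemma inner_taylor_mono N f n : fock_inner (taylor N f) (mono n) =
  if (n < N)%N then fock_inner f (mono n) else 0.
Proof.
rewrite inner_suml; [|by move=> k; exact: fock_mono|exact: fock_mono].
case: ltnP => nN.
  rewrite (bigD1 (Ordinal nN))//= mono_orthogonal eqxx big1 ?addr0 ?divfK ?fact_neq0// => k kn.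
  by rewrite mono_orthogonal ifN ?mulr0.
rewrite big1// => k _; rewrite mono_orthogonal ifN ?mulr0//.
by apply: contraTneq (ltn_ord k) => ->; rewrite -leqNgt.
Qed.

(** The squared modulus of the coordinate of [f] along the normalized n-th
    monomial. *)
Definition energy n f : R := cabs (fock_inner f (mono n)) ^+ 2 / (n`!)%:R.

Lemma energy_ge0 n f : 0 <= energy n f.
Proof. by rewrite divr_ge0 ?sqr_ge0. Qed.

Lemma inner_taylor_self N f : fock f ->
  fock_inner (taylor N f) f = (\sum_(k < N) energy k f)%:C.
Proof.
move=> ff; rewrite inner_suml//; last by move=> k; exact: fock_mono.
rewrite rmorph_sum/=; apply: eq_bigr => k _.
rewrite (fock_innerC ff (fock_mono k)) /coef mulrAC mulrJ.
by rewrite [RHS](rmorphM (real_complex R)) (fmorphV (real_complex R)) (rmorph_nat (real_complex R)).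
Qed.

(** Pythagoras: [f - P_N f] is orthogonal to the polynomials of degree less than
    [N]. *)
Lemma sqn_sub_taylor N f : fock f ->
  sqn (fun z => f z - taylor N f z) = sqn f - \sum_(k < N) energy k f.
Proof.
move=> ff; have fP := fock_taylor N f; have fd := fockB ff fP.
apply: (@complexI R); rewrite -fock_inner_self// fock_innerBr//.
have -> : fock_inner (fun z => f z - taylor N f z) (taylor N f) = 0.
  rewrite inner_sumr//; last by move=> k; exact: fock_mono.
  rewrite big1// => k _; rewrite fock_innerBl//; last exact: fock_mono.
  by rewrite inner_taylor_mono ltn_ord subrr mulr0.
rewrite subr0 fock_innerBl// fock_inner_self// rmorphB/=; congr (_ - _).
by rewrite inner_taylor_self.
Qed.

Lemma sqn_taylor N f : fock f -> sqn (taylor N f) = \sum_(k < N) energy k f.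
Proof.
move=> ff; have fP := fock_taylor N f.
apply: (@complexI R); rewrite -fock_inner_self// -(inner_taylor_self N ff).
rewrite !inner_suml//; [|by move=> k; exact: fock_mono..].
apply: eq_bigr => k _; congr (_ * _).
rewrite (fock_innerC fP (fock_mono k)) (fock_innerC ff (fock_mono k)).
by rewrite inner_taylor_mono ltn_ord.
Qed.

Lemma sqn_taylor_sub M N f : fock f -> (N <= M)%N ->
  sqn (fun z => taylor M f z - taylor N f z) = \sum_(k < M) energy k f - \sum_(k < N) energy k f.
Proof.
move=> ff NM; have fM := fock_taylor M f.
have iE (k : 'I_N) : fock_inner (taylor M f) (mono k) = fock_inner f (mono k).
  by rewrite inner_taylor_mono (leq_trans (ltn_ord k) NM).
have -> : taylor N f = taylor N (taylor M f).
  by apply/funext => z; apply: eq_bigr => k _; rewrite /coef iE.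
rewrite sqn_sub_taylor// sqn_taylor//; congr (_ - _).
by apply: eq_bigr => k _; rewrite /energy iE.
Qed.

Lemma bessel N f : fock f -> \sum_(k < N) energy k f <= sqn f.
Proof. by move=> ff; rewrite -subr_ge0 -sqn_sub_taylor// sqn_ge0. Qed.

Lemma kernel_energy k z : energy k (fock_kernel z) = (cabs z ^+ 2) ^+ k / (k`!)%:R.
Proof.
rewrite /energy (fock_innerC (fock_mono k) (fock_kernel_fock z)) (fock_reproducing z (fock_mono k)).
by rewrite cabsJ /mono cabsX exprAC.
Qed.

Lemma sqn_kernel z : sqn (fock_kernel z) = expR (cabs z ^+ 2).
Proof.
apply: (@complexI R); have fk := fock_kernel_fock z.
by rewrite -fock_inner_self// fock_reproducing// /fock_kernel mulrJ cexp_real.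
Qed.

(** The squared norms of the remainders of [k_z] are the remainders of the
    exponential series at [|z|^2]. *)
Lemma kernel_tail_cvg z :
  (fun N => sqn (fun w => fock_kernel z w - taylor N (fock_kernel z) w)) @ \oo --> (0 : R).
Proof.
have fk := fock_kernel_fock z.
(* partial sums of the exponential series at |z|^2 *)
have cE : (fun N => \sum_(k < N) energy k (fock_kernel z)) @ \oo --> expR (cabs z ^+ 2).
  rewrite (_ : (fun N => _) = series (exp_coeff (cabs z ^+ 2))).
    exact: is_cvg_series_exp_coeff.
  by apply/funext => N; rewrite /series/= big_mkord; apply: eq_bigr => k _; rewrite kernel_energy.
rewrite (_ : (fun N => sqn _) = (fun N => expR (cabs z ^+ 2) - \sum_(k < N) energy k (fock_kernel z))).
  by rewrite -[X in _ --> X](subrr (expR (cabs z ^+ 2))); apply: cvgB; [exact: cvg_cst|exact: cE].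
by apply/funext => N; rewrite sqn_sub_taylor// sqn_kernel.
Qed.

(** As [f - P_N f] is orthogonal to polynomials of degree less than [N],
    [f(z) - P_N f(z) = <f - P_N f, k_z - P_N k_z>], and the right-hand factor
    tends to zero. *)
Lemma taylor_cvg f z : fock f -> forall e : R, 0 < e -> \forall N \near \oo, cabs (f z - taylor N f z) <= e.
Proof.
move=> ff e e0; have fk := fock_kernel_fock z.
have key N : cabs (f z - taylor N f z) <= fock_norm f * fock_norm (fun w => fock_kernel z w - taylor N (fock_kernel z) w).
  have fT := fock_taylor N f; have fd := fockB ff fT.
  have fkT := fock_taylor N (fock_kernel z); have fkd := fockB fk fkT.
  rewrite -(fock_reproducing z ff) -(fock_reproducing z fT) -fock_innerBl//.
  have -> : fock_inner (fun w => f w - taylor N f w) (fock_kernel z) =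
      fock_inner (fun w => f w - taylor N f w) (fun w => fock_kernel z w - taylor N (fock_kernel z) w).
    rewrite (fock_innerBr fk fkT fd).
    suff -> : fock_inner (fun w => f w - taylor N f w) (taylor N (fock_kernel z)) = 0 by rewrite subr0.
    rewrite inner_sumr//; last by move=> k; exact: fock_mono.
    rewrite big1// => k _; rewrite fock_innerBl//; last exact: fock_mono.
    by rewrite inner_taylor_mono ltn_ord subrr mulr0.
  apply: (le_trans (fock_cauchy_schwarz fd fkd)); rewrite ler_wpM2r ?fock_norm_ge0//.
  rewrite /fock_norm -/(sqn _) -/(sqn f) ler_wsqrtr// sqn_sub_taylor// gerBl sumr_ge0// => k _.
  exact: energy_ge0.
have e1 : 0 < (e / (fock_norm f + 1)) ^+ 2.
  by rewrite exprn_gt0// divr_gt0// ltr_wpDl ?fock_norm_ge0.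
have /cvgrPdist_le/(_ _ e1) := kernel_tail_cvg z; apply: filterS => N.
rewrite sub0r normrN ger0_norm ?sqn_ge0// => h; apply: (le_trans (key N)).
have : fock_norm (fun w => fock_kernel z w - taylor N (fock_kernel z) w) <= e / (fock_norm f + 1).
  rewrite -ler_sqr ?nnegrE ?fock_norm_ge0//; last by rewrite ltW// divr_gt0// ltr_wpDl ?fock_norm_ge0.
  by rewrite fock_norm_sqr.
move=> h2; apply: (le_trans (ler_wpM2l (fock_norm_ge0 f) h2)).
rewrite mulrA ler_pdivrMr; last by rewrite ltr_wpDl ?fock_norm_ge0.
by rewrite mulrC ler_wpM2l ?(ltW e0)//; lra.
Qed.

Lemma energy_cvg f : fock f -> exists S : R, (fun N => \sum_(k < N) energy k f) @ \oo --> S.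
Proof.
move=> ff; apply/cvg_ex; apply: nondecreasing_is_cvgn.
  apply/nondecreasing_seqP => n; rewrite big_ord_recr/= lerDl; exact: energy_ge0.
by exists (sqn f) => _ [N _ <-]; exact: bessel.
Qed.

(** Fatou's lemma for [|P_M f - P_N f|^2] as [M] grows; it takes the place of the
    completeness of the space. *)
Lemma sqn_tail_le f (S : R) N : fock f -> (fun N => \sum_(k < N) energy k f) @ \oo --> S ->
  sqn (fun z => f z - taylor N f z) <= S - \sum_(k < N) energy k f.
Proof.
move=> ff cS; have fd := fockB ff (fock_taylor N f).
pose g M (p : plane R) : R := cabs (taylor M f (pt p) - taylor N f (pt p)) ^+ 2 * omega (pt p).
have fM M := fockB (fock_taylor M f) (fock_taylor N f).
have mg M : measurable_fun setT (fun p => (g M p)%:E).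
  by apply/measurable_EFinP; exact: (measurable_sqweight (fock_entire (fM M))).
have g0 M p : [set: plane R] p -> (0 <= (g M p)%:E)%E.
  by move=> _; rewrite lee_fin mulr_ge0 ?sqr_ge0 ?omega_ge0.
have := fatou (@area R) measurableT mg g0.
have -> : (\int[area]_x limn_einf (fun n => (g n x)%:E) = (sqn (fun z => f z - taylor N f z))%:E)%E.
  rewrite -sqnE//; apply: eq_integral => p _.
  apply: (cvg_limn_einf_sup _).1; apply: cvg_EFin; first by apply: nearW.
  apply: cvgM; last exact: cvg_cst.
  have c1 : (fun M => cabs (taylor M f (pt p) - taylor N f (pt p))) @ \oo --> cabs (f (pt p) - taylor N f (pt p)).
    apply/cvgrPdist_le => e e0; near=> M.
    apply: (@le_trans _ _ (cabs (f (pt p) - taylor M f (pt p)))); last by near: M; exact: taylor_cvg.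
    rewrite ler_norml; set a := f _; set b := taylor M f _; set c := taylor N f _.
    have h1 : cabs (a - c) <= cabs (a - b) + cabs (b - c) by rewrite (le_trans _ (cabsD _ _))// subrKA.
    have h2 : cabs (b - c) <= cabs (a - b) + cabs (a - c).
      by rewrite (cabs_distrC a b) (le_trans _ (cabsD _ _))// subrKA.
    by apply/andP; split; lra.
  by under eq_cvg do rewrite expr2; rewrite expr2; exact: cvgM.
have -> : limn_einf (fun M => \int[area]_x (g M x)%:E)%E = (S - \sum_(k < N) energy k f)%:E.
  apply: (cvg_limn_einf_sup _).1.
  apply: (@cvg_trans _ ((fun M => (\sum_(k < M) energy k f - \sum_(k < N) energy k f)%:E) @ \oo)).
    apply: near_eq_cvg; near=> M; rewrite -sqn_taylor_sub//; last by near: M; exact: nbhs_infty_ge.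
    by rewrite -sqnE.
  apply: cvg_EFin; first by apply: nearW.
  by apply: cvgB => //; exact: cvg_cst.
by rewrite lee_fin.
Unshelve. all: by end_near. Qed.

Lemma taylor_norm_cvg f : fock f ->
  (fun N => fock_norm (fun z => f z - taylor N f z)) @ \oo --> (0 : R).
Proof.
move=> ff; have [S cS] := energy_cvg ff.
have c0 : (fun N => S - \sum_(k < N) energy k f) @ \oo --> (0 : R).
  by rewrite -[X in _ --> X](subrr S); apply: cvgB; [exact: cvg_cst|exact: cS].
have c1 : (fun N => sqn (fun z => f z - taylor N f z)) @ \oo --> (0 : R).
  apply: (squeeze_cvgr _ (cvg_cst 0) c0); near=> N.
  by rewrite sqn_ge0 sqn_tail_le.
have := cvg_comp _ _ c1 (@sqrt_continuous R 0).
by rewrite sqrtr0.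
Unshelve. all: by end_near. Qed.

Lemma fock_norm_taylor_le N f : fock f -> fock_norm (taylor N f) <= fock_norm f.
Proof.
move=> ff; rewrite /fock_norm -/(sqn _) -/(sqn f) ler_wsqrtr//.
by rewrite sqn_taylor// bessel.
Qed.

End Taylor.

(** * Point masses at the origin *)

Section PointMass.
Context {R : realType}.
Implicit Types (f g : R[i] -> R[i]) (c : R[i]).

Definition origin : plane R := pt_inv 0.

Lemma pt_origin : pt origin = 0 :> R[i].
Proof. by []. Qed.

Lemma omega0 : omega (0 : R[i]) = pi^-1.
Proof. by rewrite /omega cabs0 expr0n oppr0 expR0 mulr1. Qed.

Definition point_mass c (A : set (plane R)) : R[i] := if origin \in A then c else 0.

Lemma point_mass_lf c : lf_complex_measure (point_mass c).
Proof.
move=> A mA tA bA; rewrite /point_mass.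
have [[k _ Ak]|nA] := pselect ((\bigcup_i A i) origin); last first.
  rewrite (_ : (_ \in _) = false); last by apply/negbTE; rewrite notin_setE.
  rewrite (_ : (fun n => _) = (fun=> 0 : R[i]^o)); first exact: cvg_cst.
  apply/funext => n; rewrite big1// => i _; rewrite ifF//; apply/negbTE.
  by rewrite notin_setE => Ai; apply: nA; exists i.
rewrite (@mem_set _ _ origin); last by exists k.
apply: cvg_near_cst; exists k.+1 => // n /= kn.
rewrite (bigD1_seq k) ?mem_index_iota ?iota_uniq//= mem_set// big1 ?addr0//.
move=> i ik; rewrite ifF//; apply/negbTE; rewrite notin_setE => Ai.
by move/eqP: ik; apply; apply: tA => //; exists origin.
Qed.

Lemma bounded_origin : bounded_borel [set origin].
Proof.
split; first by rewrite (_ : [set origin] = [set (0 : measurableTypeR R)] `*` [set (0 : measurableTypeR R)]);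
   [apply: measurableX; exact: measurable_set1|apply/seteqP; split => -[x y] /= []// -> ->].
by exists 1 => _ ->; rewrite /disk/= pt_origin subrr cabs0.
Qed.

(** At most one of finitely many disjoint sets contains the origin; the supremum
    is attained by the singleton, and by the empty family when the origin is
    not in [A]. *)
Lemma abs_point_mass c A : abs_measure (point_mass c) A = (cabs c * (\1_A origin))%:E.
Proof.
apply/eqP; rewrite eq_le; apply/andP; split.
  apply: ge_ereal_sup => _ [n [E [bE tE ->]]]; rewrite lee_fin indicE.
  have [[k Ek]|nE] := pselect (exists k, E k origin).
    rewrite (bigD1 k)//= {1}/point_mass mem_set// big1 ?addr0.
      have /= := (bE k).2 _ Ek => Ao; rewrite mem_set//= mulr1//.
    move=> i ik; rewrite /point_mass ifF ?cabs0//; apply/negbTE; rewrite notin_setE => Ei.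
    by move/eqP: ik; apply; apply: tE => //; exists origin.
  rewrite big1 ?mulr_ge0 ?cabs_ge0// => i _; rewrite /point_mass ifF ?cabs0//.
  by apply/negbTE; rewrite notin_setE => Ei; apply: nE; exists i.
rewrite indicE; have [Ao|nAo] := boolP (origin \in A).
  apply: ereal_sup_ubound; exists 1%N, (fun=> [set origin]); split.
  - move=> _; split; first exact: bounded_origin.
    by move=> _ ->; move: Ao; rewrite inE.
  - by move=> i j _ _ _; rewrite !ord1.
  - by rewrite big_ord1 /point_mass mem_set//= mulr1.
apply: ereal_sup_ubound; exists 0%N, (fun=> set0); split => //.
- by move=> [].
- by move=> [].
- by rewrite big_ord0/= mulr0.
Qed.

Definition pos_mass (r : R) (r0 : 0 <= r) : {measure set (plane R) -> \bar R} :=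
  mscale (NngNum r0) (dirac origin).

(** The set functions at hand are known only by their values; as these are the
    values of a multiple of the Dirac measure, integrals can be computed. *)
Lemma integral_pos_mass (r : R) (r0 : 0 <= r) (mu : set (plane R) -> \bar R) (h : plane R -> R) :
  (forall A, mu A = (r * \1_A origin)%:E) ->
  measurable_fun setT h -> (\int[mu]_p (h p)%:E = (r * h origin)%:E)%E.
Proof.
move=> muE mh; have -> : mu = pos_mass r0.
  by apply/funext => A; rewrite muE /pos_mass/= /mscale/= diracE EFinM indicE.
have mE : measurable_fun setT (fun p => (h p)%:E) by exact/measurable_EFinP.
have mp := measurable_funepos mE; have mn := measurable_funeneg mE.
rewrite integralE !ge0_integral_mscale//= !integral_dirac//= !diracT !mul1e.
rewrite funeposE funenegE -EFin_max -EFinN -EFin_max -!EFinM -EFinB.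
rewrite -mulrBr; congr ((_ * _)%:E); case: (leP (h origin) 0) => h0; case: (leP (- h origin) 0) => h1; lra.
Qed.

Lemma positive_part_point_mass (r : R) (nu : set (plane R) -> R) A :
  (forall B, nu B = if origin \in B then r else 0) ->
  positive_part nu A = (Num.max r 0 * \1_A origin)%:E.
Proof.
move=> nuE; apply/eqP; rewrite eq_le indicE; apply/andP; split.
  apply: ge_ereal_sup => _ [B [bB BA] <-]; rewrite lee_fin nuE.
  case: ifPn => [Bo|_]; last by rewrite mulr_ge0// le_max lexx orbT.
  by rewrite mem_set ?mulr1 ?le_max ?lexx//; apply: BA; move: Bo; rewrite inE.
have bs0 : bounded_borel (@set0 (plane R)) by split => //; exists 0.
have zero : (0 <= ereal_sup [set (nu B)%:E | B in [set B | bounded_borel B /\ B `<=` A]])%E.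
  by apply: ereal_sup_ubound; exists set0; [split|rewrite nuE in_set0].
have [Ao|nAo] := boolP (origin \in A); last by rewrite mulr0.
rewrite mulr1; have [r0|r0] := leP r 0; first exact: zero.
apply: ereal_sup_ubound; exists [set origin]; last by rewrite nuE mem_set.
by split; [exact: bounded_origin|move=> _ ->; move: Ao; rewrite inE].
Qed.

Lemma signed_integral_point_mass (r : R) (nu : set (plane R) -> R) (h : plane R -> R) :
  (forall B, nu B = if origin \in B then r else 0) -> measurable_fun setT h ->
  signed_integral nu h = r * h origin.
Proof.
move=> nuE mh; have m0 (s : R) : 0 <= Num.max s 0 by rewrite le_max lexx orbT.
rewrite /signed_integral (integral_pos_mass (m0 r))//; last by move=> A; exact: positive_part_point_mass.
rewrite (integral_pos_mass (m0 (- r)))//; last first.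
  move=> A; apply: positive_part_point_mass => B; rewrite nuE; case: ifP => //; by rewrite oppr0.
rewrite /= -mulrBl; congr (_ * _); case: (leP r 0) => r0; case: (leP (- r) 0) => r1; lra.
Qed.

Lemma complex_integral_point_mass c h : cmeas h ->
  complex_integral (point_mass c) h = c * h origin.
Proof.
move=> [h1 h2]; rewrite /complex_integral.
have E1 B : complex.Re (point_mass c B) = if origin \in B then complex.Re c else 0 by rewrite /point_mass; case: ifP.
have E2 B : complex.Im (point_mass c B) = if origin \in B then complex.Im c else 0 by rewrite /point_mass; case: ifP.
rewrite !(signed_integral_point_mass E1)// !(signed_integral_point_mass E2)//.
by apply: complex_ext; rewrite ?ReM ?ImM//=; ring.
Qed.

Lemma cmeas_cderiv n f : fock f -> cmeas (fun p => cderiv n f (pt p)).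
Proof. by move=> ff; apply: entire_cmeas; exact: entire_cderiv. Qed.

(** The k-th derivative at the origin is the inner product with the k-th
    monomial, so Cauchy-Schwarz gives the constant. *)
Lemma FC_integer_point_mass k c : FC_integer k (point_mass c).
Proof.
exists (cabs c * sqn (@mono R k)) => f ff.
have mh : measurable_fun setT (fun p : plane R => cabs (cderiv k f (pt p)) ^+ 2 * expR (- cabs (pt p) ^+ 2)).
  apply: measurable_funM; first by apply: measurable_funX; apply: measurable_cabs; exact: cmeas_cderiv.
  apply: measurableT_comp; first exact: measurable_expR.
  apply: measurableT_comp => //; apply: measurable_funX.
  by apply: measurable_cabs; apply: (@entire_cmeas R (fun z => z)); exact: entire_id.
rewrite (integral_pos_mass (cabs_ge0 c) (@abs_point_mass c) mh) sqnE//.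
rewrite -EFinM lee_fin pt_origin cabs0 expr0n oppr0 expR0 mulr1 -mulrA.
rewrite ler_wpM2l ?cabs_ge0// -inner_mono// -!fock_norm_sqr mulrC -exprMn.
rewrite ler_sqr ?nnegrE ?mulr_ge0 ?fock_norm_ge0 ?cabs_ge0//.
exact: fock_cauchy_schwarz (fock_mono k).
Qed.

(** Only disks whose centre is within [sqrt 2] of the origin are charged, and
    there [1 + |z|^2] is at most 3. *)
Lemma FC_half_point_mass (k : R) c : 0 <= k -> FC_half_integer k (point_mass c).
Proof.
move=> k0; exists (cabs c * 3 `^ k) => z; rewrite abs_point_mass indicE.
case: (boolP (origin \in _)) => [|_]; last first.
  by rewrite mulr0 mul0e lee_fin mulr_ge0 ?cabs_ge0 ?powR_ge0.
rewrite inE /disk/= pt_origin sub0r cabsN => z2.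
rewrite mulr1 -EFinM lee_fin ler_wpM2l ?cabs_ge0// ge0_ler_powR ?nnegrE ?addr_ge0 ?sqr_ge0//.
have : cabs z ^+ 2 <= Num.sqrt 2 ^+ 2 by rewrite ler_sqr ?nnegrE ?cabs_ge0 ?sqrtr_ge0// ltW.
by rewrite sqr_sqrtr//; lra.
Qed.

Lemma FC_point_mass n c : FC n (point_mass c).
Proof.
rewrite /FC; case: ifP => _; last exact: FC_integer_point_mass.
by apply: FC_half_point_mass; rewrite divr_ge0.
Qed.

Lemma F_ab_point_mass c a b f g : fock f -> fock g ->
  F_ab (point_mass c) a b f g = (-1) ^+ (a + b) * (c * (cderiv a f 0 * (cderiv b g 0)^* * (pi^-1)%:C)).
Proof.
move=> ff fg; rewrite /F_ab complex_integral_point_mass ?pt_origin ?omega0//.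
apply: cmeasM; last by apply: cmeas_real; exact: measurable_omega.
by apply: cmeasM; [exact: cmeas_cderiv|apply: cmeasJ; exact: cmeas_cderiv].
Qed.

End PointMass.

(** The n-th shell is the last column together with the last row of the square of
    side [n + 1]. *)
Lemma sum_shells (V : zmodType) (X : nat -> nat -> V) n :
  \sum_(0 <= j < n) \sum_(a < j.+1) \sum_(b < j.+1 | maxn a b == j) X a b =
  \sum_(a < n) \sum_(b < n) X a b.
Proof.
elim: n => [|n ih]; first by rewrite big_geq// big_ord0.
rewrite big_nat_recr//= ih.
rewrite [RHS]big_ord_recr/=; under [X in _ = X + _]eq_bigr do rewrite big_ord_recr/=.
rewrite big_split/= -addrA; congr (_ + _).
rewrite big_ord_recr/=; congr (_ + _).
  apply: eq_bigr => a _; rewrite big_mkcond big_ord_recr/= (maxn_idPr (ltnW (ltn_ord a))) eqxx.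
  by rewrite big1 ?add0r// => b _; rewrite ifN// neq_ltn gtn_max !ltn_ord.
by apply: eq_bigl => b; apply/eqP/maxn_idPl; rewrite -ltnS.
Qed.

(** * Bounded operators *)

Section Main.
Context {R : realType} (T : (complex R -> complex R) -> (complex R -> complex R)).
Context (hT : bounded_operator T).
Implicit Types (f g : R[i] -> R[i]).

Let form f g := fock_inner (T f) g.

Let T_fock f : fock f -> fock (T f).
Proof. by case: hT => + _ _; apply. Qed.

Let T_lin a f g : fock f -> fock g -> T (fun z => a * f z + g z) = (fun z => a * T f z + T g z).
Proof. by case: hT => _ + _ => H ff fg; apply/funext; exact: H. Qed.

Let form_linl a f g k : fock f -> fock g -> fock k ->
  form (fun z => a * f z + g z) k = a * form f k + form g k.
Proof. by move=> ff fg fk; rewrite /form T_lin// fock_innerDl//; exact: T_fock. Qed.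

Let form_linr a f g k : fock k -> fock f -> fock g ->
  form k (fun z => a * f z + g z) = a^* * form k f + form k g.
Proof. by move=> fk ff fg; rewrite /form fock_innerDr//; exact: T_fock. Qed.

Let form_bound : exists2 M : R, 0 <= M & forall f g, fock f -> fock g ->
  cabs (form f g) <= M * fock_norm f * fock_norm g.
Proof.
case: hT => _ _ [M HM]; exists `|M| => // f g ff fg.
apply: (le_trans (fock_cauchy_schwarz (T_fock ff) fg)); rewrite ler_wpM2r ?fock_norm_ge0//.
by apply: (le_trans (HM f ff)); rewrite ler_wpM2r ?fock_norm_ge0// ler_norm.
Qed.

Lemma form_sesquilinear : bounded_sesquilinear form.
Proof.
split.
- by move=> a f1 f2 g ? ? ?; exact: form_linl.
- by move=> a f g1 g2 ? ? ?; exact: form_linr.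
- by have [M _ HM] := form_bound; exists M.
Qed.

Let form0l k : fock k -> form (fun=> 0) k = 0.
Proof.
move=> fk; have := form_linl (-1) (@fock_cst0 R) (@fock_cst0 R) fk.
by under eq_fun do rewrite mulr0 addr0; rewrite mulN1r addNr.
Qed.

Lemma form_taylor n f g : fock f -> fock g ->
  form (taylor n f) (taylor n g) = \sum_(a < n) \sum_(b < n) coef a f * ((coef b g)^* * form (mono a) (mono b)).
Proof.
move=> ff fg; have sl N (c : 'I_N -> R[i]) (F : 'I_N -> R[i] -> R[i]) k : (forall i, fock (F i)) -> fock k ->
    form (fun w => \sum_(i < N) c i * F i w) k = \sum_(i < N) c i * form (F i) k.
  move=> + fk; elim: N c F => [|N ih] c F fF.
    by under eq_fun do rewrite big_ord0; rewrite big_ord0 form0l.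
  under eq_fun do rewrite big_ord_recr/= addrC.
  pose w' := widen_ord (leqnSn N).
  rewrite form_linl//; last exact: (@fock_sum _ _ (fun k => c (w' k)) (fun k => F (w' k))).
  by rewrite (ih (fun k => c (w' k)) (fun k => F (w' k)))// big_ord_recr/= addrC.
rewrite sl; [|by move=> k; exact: fock_mono|exact: fock_taylor].
apply: eq_bigr => a _; rewrite /form inner_sumr; [|by move=> k; exact: fock_mono|exact: T_fock (fock_mono a)].
by rewrite mulr_sumr.
Qed.

(** Boundedness of the form splits the error into the two Taylor remainders. *)
Lemma form_taylor_cvg f g : fock f -> fock g ->
  ((fun n => form (taylor n f) (taylor n g)) : nat -> R[i]^o) @ \oo --> (form f g : R[i]^o).
Proof.
move=> ff fg; have [M M0 HM] := form_bound.
have key n : cabs (form f g - form (taylor n f) (taylor n g)) <=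
   M * fock_norm (fun z => f z - taylor n f z) * fock_norm g + M * fock_norm f * fock_norm (fun z => g z - taylor n g z).
  have fP := fock_taylor n f; have gP := fock_taylor n g.
  have fd := fockB ff fP; have gd := fockB fg gP.
  have E1 : form (fun z => f z - taylor n f z) g = form f g - form (taylor n f) g.
    have := form_linl (-1) fP ff fg.
    by under eq_fun do rewrite mulN1r addrC; rewrite mulN1r addrC.
  have E2 : form (taylor n f) (fun z => g z - taylor n g z) = form (taylor n f) g - form (taylor n f) (taylor n g).
    by rewrite /form fock_innerBr//; exact: T_fock.
  have -> : form f g - form (taylor n f) (taylor n g) =
     form (fun z => f z - taylor n f z) g + form (taylor n f) (fun z => g z - taylor n g z).
    by rewrite E1 E2 subrKA.
  apply: (le_trans (cabsD _ _)); apply: lerD; first exact: HM.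
  apply: (le_trans (HM _ _ fP gd)); rewrite ler_wpM2r ?fock_norm_ge0// ler_wpM2l//.
  exact: fock_norm_taylor_le.
have c0 : (fun n => M * fock_norm (fun z => f z - taylor n f z) * fock_norm g + M * fock_norm f * fock_norm (fun z => g z - taylor n g z)) @ \oo --> (M * 0 * fock_norm g + M * fock_norm f * 0 : R).
  apply: cvgD; apply: cvgM; try exact: cvg_cst; last exact: taylor_norm_cvg.
  by apply: cvgM; [exact: cvg_cst|exact: taylor_norm_cvg].
rewrite mulr0 mul0r mulr0 addr0 in c0.
apply/cvgrPdist_le => /= e e0.
have er : 0 < complex.Re e by move: e0; rewrite ltcE/= => /andP[].
have eE : e = (complex.Re e)%:C by move: e0; rewrite ltcE/= => /andP[/eqP + _]; case: (e) => x y /= ->.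
have /cvgrPdist_le/(_ _ er) := c0; apply: filterS => n; rewrite sub0r normrN => h.
rewrite -cabsC eE lecR (le_trans (key n))// (le_trans (ler_norm _))//.
Qed.

(** The weight of the (a, b)-th mass cancels the sign and the factor [1/pi] of
    [F_ab], and normalizes the monomials by their squared norms [a!] and
    [b!]. *)
Lemma form_weak : weak_almost_finite form.
Proof.
split; first exact: form_sesquilinear.
pose c a b : R[i] := (-1) ^+ (a + b) * pi%:C * form (mono a) (mono b) / (a`!)%:R / (b`!)%:R.
exists (fun a b => point_mass (c a b)); split.
  by move=> a b; split; [exact: point_mass_lf|exact: FC_point_mass].
move=> f g ff fg; have := form_taylor_cvg ff fg.
rewrite (_ : (fun n => form _ _) = (fun n => \sum_(0 <= j < n) \sum_(a < j.+1) \sum_(b < j.+1 | maxn a b == j) F_ab (point_mass (c a b)) a b f g))//.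
apply/funext => n; rewrite form_taylor//.
apply: etrans (esym (sum_shells (fun a b => F_ab (point_mass (c a b)) a b f g) n)).
apply: eq_bigr => a _; apply: eq_bigr => b _.
rewrite F_ab_point_mass// /coef !inner_mono// /c conjM fmorphV rmorph_nat.
have piE : (pi%:C : R[i]) * (pi^-1)%:C = 1.
  by rewrite -(rmorphM (real_complex R)) mulfV ?rmorph1// gt_eqF// pi_gt0.
have sE : ((-1) ^+ (a + b) : R[i]) * (-1) ^+ (a + b) = 1 by rewrite -expr2 sqrr_sign.
set s := (-1) ^+ _ in sE *; set p := pi%:C in piE *; set q := (pi^-1)%:C in piE *.
set A := (_%:R)^-1; set B := (_%:R)^-1; set F1 := cderiv a f 0; set G1 := _^*; set t := form _ _.
have -> : s * (s * p * t * A * B * (F1 * G1 * q)) = (s * s) * (p * q) * (t * A * B * F1 * G1) by ring.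
by rewrite sE piE; ring.
Qed.

End Main.

Theorem theorem6p13 (R : realType)
    (T : (complex R -> complex R) -> (complex R -> complex R))
    (hT : bounded_operator T) :
  let F := fun f g : complex R -> complex R => fock_inner (T f) g in
  weak_almost_finite F /\
  (forall f : complex R -> complex R, fock f -> T f = toeplitz F f).
Proof.
split; first exact: form_weak.
move=> f ff; apply/funext => z; rewrite /toeplitz fock_reproducing//.
by case: hT => + _ _; apply.
Qed.
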